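(* For every fixed $k,m\in\mathbb N$ the following problem is decidable: given finite alphabets $A,B$ and a timed automaton with $\varepsilon$-transitions recognising (with Büchi acceptance) a timed $\omega$-language $W\subseteq (A\times B\times\mathbb R_{\ge0})^\omega$ over the alphabet $A\times B$, decide whether Player II has a winning $k,m$-controller in the timed synthesis game $G(A,B,W)$.
   Context: Timed words and clock constraints: a timed word over $\Sigma$ is a sequence $(a_1,t_1)(a_2,t_2)\cdots$, $a_i\in\Sigma$, $0\le t_1\le t_2\le\cdots$ reals; clock constraints over clocks $X$ are Boolean combinations of $x\sim z$, $x-y\sim z$ ($z\in\mathbb Z$, $\sim\in\{<,\le,=,\ge,>\}$). A timed automaton with $\varepsilon$-transitions $(\Sigma,L,X,I,F,\Delta)$ has rules $(p,a,\varphi,Y,q)$, $a\in\Sigma\cup\{\varepsilon\}$, taken after a time elapse when the current valuation satisfies $\varphi$, resetting $Y$ to $0$; runs start in $I$ with all clocks $0$. Its timed $\omega$-language consists of the infinite timed words over $\Sigma$ obtained, by deleting $\varepsilon$-letters, from infinite accepted words (runs visiting $F$ infinitely often), keeping only infinite results. For a set of clocks $X$ and $m\in\mathbb N$, two valuations are $(X,m)$-region equivalent if they satisfy the same clock constraints over $X$ with constants of absolute value at most $m$; the equivalence classes (finitely many) are regions. Timed synthesis game $G(A,B,W)$: in rounds $i=1,2,\dots$ Player I chooses $a_i\in A$ and $t_i\in\mathbb R_{\ge0}$ with $t_i\ge t_{i-1}$ ($t_0=0$), then Player II chooses $b_i\in B$; Player I wins iff the play $(a_1,b_1,t_1)(a_2,b_2,t_2)\cdots\in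 W$. A $k,m$-controller for Player II is $(A,B,L,\ell_0,\delta)$ with finite memory set $L$, $\ell_0\in L$, a set $X$ of $k$ clocks, and $\delta: L\times A\times\mathrm{Regions}(X,m)\to L\times B\times 2^X$. It plays as follows: starting from $\ell_0$ and the all-zero valuation $\mu_0$, on Player I's move $(a_{n+1},t_{n+1})$ with current $(\ell_n,\mu_n)$, let $\nu=\mu_n+(t_{n+1}-t_n)$ and $\delta(\ell_n,a_{n+1},[\nu])=(\ell',b,Y)$; it answers $b_{n+1}=b$ and updates to $\ell_{n+1}=\ell'$, $\mu_{n+1}=\nu$ with clocks in $Y$ reset to $0$. It is winning if no infinite play consistent with it belongs to $W$. *)

(* Defs.v *)
From Stdlib Require Import Reals ZArith.
From mathcomp Require Import ssreflect ssrfun ssrbool eqtype ssrnat seq choice fintype finset.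

Set Implicit Arguments.
Unset Strict Implicit.
Unset Printing Implicit Defensive.

(* 1. A model of computation: partial recursive (mu-recursive) functions    *)
(*    on nat, in unary form using the Cantor pairing function.              *)

Definition cpair (a b : nat) : nat := ((a + b) * (a + b).+1)./2 + b.

Inductive code : Type :=
  | CZero
  | CSucc
  | CFst
  | CSnd
  | CComp (f g : code)
  | CPair (f g : code)
  | CRec (f g : code)
  | CMu (f : code).

Inductive eval : code -> nat -> nat -> Prop :=
  | eZero n : eval CZero n 0
  | eSucc n : eval CSucc n n.+1
  | eFst a b : eval CFst (cpair a b) a
  | eSnd a b : eval CSnd (cpair a b) b
  | eComp f g n m k : eval g n m -> eval f m k -> eval (CComp f g) n k
  | ePair f g n a b : eval f n a -> eval g n b -> eval (CPair f g) n (cpair a b)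
  | eRec0 f g x a : eval f x a -> eval (CRec f g) (cpair x 0) a
  | eRecS f g x n a b :
      eval (CRec f g) (cpair x n) a ->
      eval g (cpair x (cpair n a)) b ->
      eval (CRec f g) (cpair x n.+1) b
  | eMu f x n :
      eval f (cpair x n) 0 ->
      (forall i, i < n -> exists v, v <> 0 /\ eval f (cpair x i) v) ->
      eval (CMu f) x n.

Definition computably_decidable (X : Type) (enc : X -> nat) (P : X -> Prop) : Prop :=
  exists c : code, forall x : X,
    (P x -> eval c (enc x) 1) /\ (~ P x -> eval c (enc x) 0).

(*    Clocks and locations are named by natural numbers; the clocks / locations *)
(*    of an automaton are those occurring in it.                             *)

Inductive cmp : Type := CLt | CLe | CEq | CGe | CGt.

Inductive guard : Type :=
  | GTrue
  | GAtom (x : nat) (c : cmp) (z : Z)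
  | GDiff (x y : nat) (c : cmp) (z : Z)
  | GNot (g : guard)
  | GAnd (g1 g2 : guard)
  | GOr (g1 g2 : guard).

(* a rule (p, a, phi, Y, q); the label is None for epsilon, Some (a, b) for the
   letter (a, b) of the alphabet A x B = 'I_nA x 'I_nB. *)
Record rule : Type := Rule {
  r_src : nat;
  r_lab : option (nat * nat);
  r_guard : guard;
  r_reset : seq nat;
  r_dst : nat }.

Record TA : Type := MkTA {
  ta_init : seq nat;
  ta_final : seq nat;
  ta_rules : seq rule }.

(* An instance of the decision problem: sizes of the alphabets A = 'I_nA,
   B = 'I_nB, and a timed automaton over A x B. *)
Record instance : Type := Inst {
  i_nA : nat;
  i_nB : nat;
  i_ta : TA }.

Definition enc_Z (z : Z) : nat :=
  if (0 <=? z)%Z then cpair 0 (Z.to_nat z) else cpair 1 (Z.to_nat (- z)).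

Definition enc_cmp (c : cmp) : nat :=
  match c with CLt => 0 | CLe => 1 | CEq => 2 | CGe => 3 | CGt => 4 end.

Fixpoint enc_guard (g : guard) : nat :=
  match g with
  | GTrue => cpair 0 0
  | GAtom x c z => cpair 1 (cpair x (cpair (enc_cmp c) (enc_Z z)))
  | GDiff x y c z => cpair 2 (cpair x (cpair y (cpair (enc_cmp c) (enc_Z z))))
  | GNot g1 => cpair 3 (enc_guard g1)
  | GAnd g1 g2 => cpair 4 (cpair (enc_guard g1) (enc_guard g2))
  | GOr g1 g2 => cpair 5 (cpair (enc_guard g1) (enc_guard g2))
  end.

Fixpoint enc_seq (T : Type) (f : T -> nat) (s : seq T) : nat :=
  match s with
  | [::] => 0
  | x :: s' => (cpair (f x) (enc_seq f s')).+1
  end.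

Definition enc_lab (l : option (nat * nat)) : nat :=
  match l with None => 0 | Some (a, b) => (cpair a b).+1 end.

Definition enc_rule (r : rule) : nat :=
  cpair (r_src r) (cpair (enc_lab (r_lab r))
    (cpair (enc_guard (r_guard r)) (cpair (enc_seq id (r_reset r)) (r_dst r)))).

Definition enc_TA (T : TA) : nat :=
  cpair (enc_seq id (ta_init T)) (cpair (enc_seq id (ta_final T)) (enc_seq enc_rule (ta_rules T))).

Definition enc_instance (I : instance) : nat :=
  cpair (i_nA I) (cpair (i_nB I) (enc_TA (i_ta I))).

Definition cmpR (c : cmp) (u v : R) : Prop :=
  match c with
  | CLt => (u < v)%R | CLe => (u <= v)%R | CEq => u = v
  | CGe => (u >= v)%R | CGt => (u > v)%R
  end.

Fixpoint sat (nu : nat -> R) (g : guard) : Prop :=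
  match g with
  | GTrue => True
  | GAtom x c z => cmpR c (nu x) (IZR z)
  | GDiff x y c z => cmpR c (nu x - nu y)%R (IZR z)
  | GNot g1 => ~ sat nu g1
  | GAnd g1 g2 => sat nu g1 /\ sat nu g2
  | GOr g1 g2 => sat nu g1 \/ sat nu g2
  end.

Definition prev (t : nat -> R) (n : nat) : R :=
  match n with 0 => 0%R | n'.+1 => t n' end.

(* clock valuation of a run (rules r taken at absolute times s) just before
   the j-th step's time elapse; all clocks start at 0. *)
Fixpoint run_val (r : nat -> rule) (s : nat -> R) (j : nat) : nat -> R :=
  match j with
  | 0 => fun _ => 0%R
  | j'.+1 => fun x =>
      if x \in r_reset (r j') then 0%R
      else (run_val r s j' x + (s j' - prev s j'))%R
  end.

(* infinite accepting (Buchi) run of T, as the sequence of rules taken and the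
   (absolute) times at which they are taken *)
Definition accepting_run (T : TA) (r : nat -> rule) (s : nat -> R) : Prop :=
  r_src (r 0) \in ta_init T /\
  (forall j, List.In (r j) (ta_rules T)) /\
  (forall j, r_dst (r j) = r_src (r j.+1)) /\
  (forall j, (prev s j <= s j)%R) /\
  (forall j, sat (fun x => (run_val r s j x + (s j - prev s j))%R) (r_guard (r j))) /\
  (forall N, exists j, N <= j /\ r_src (r j) \in ta_final T).

Definition timed_word (nA nB : nat) : Type := nat -> ('I_nA * 'I_nB) * R.

(* The timed omega-language of T: infinite words over A x B obtained from the
   infinite words of accepting runs by deleting epsilon letters, keeping only
   infinite results (f enumerates, increasingly, exactly the non-epsilon
   positions, of which there must be infinitely many). *)
Definition in_lang (nA nB : nat) (T : TA) (w : timed_word nA nB) : Prop :=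
  exists (r : nat -> rule) (s : nat -> R) (f : nat -> nat),
    accepting_run T r s /\
    (forall i, f i < f i.+1) /\
    (forall j, r_lab (r j) <> None <-> exists i, f i = j) /\
    (forall i, r_lab (r (f i)) = Some (nat_of_ord (w i).1.1, nat_of_ord (w i).1.2)
               /\ s (f i) = (w i).2).

Fixpoint guard_over (k m : nat) (g : guard) : Prop :=
  match g with
  | GTrue => True
  | GAtom x _ z => x < k /\ (Z.abs z <= Z.of_nat m)%Z
  | GDiff x y _ z => x < k /\ y < k /\ (Z.abs z <= Z.of_nat m)%Z
  | GNot g1 => guard_over k m g1
  | GAnd g1 g2 | GOr g1 g2 => guard_over k m g1 /\ guard_over k m g2
  end.

Definition ext_val (k : nat) (nu : 'I_k -> R) (x : nat) : R :=
  match (insub x : option 'I_k) with Some y => nu y | None => 0%R end.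

Definition region_equiv (k m : nat) (nu nu' : 'I_k -> R) : Prop :=
  forall g, guard_over k m g -> (sat (ext_val nu) g <-> sat (ext_val nu') g).

(* delta : L x A x Regions(X,m) -> L x B x 2^X, presented as a function on
   valuations that is constant on (X,m)-regions *)
Definition region_invariant (k m nA nB : nat) (L : Type)
    (delta : L -> 'I_nA -> ('I_k -> R) -> L * 'I_nB * {set 'I_k}) : Prop :=
  forall l a nu nu', region_equiv m nu nu' -> delta l a nu = delta l a nu'.

Section Controller.
Variables (k nA nB : nat) (L : Type) (l0 : L)
  (delta : L -> 'I_nA -> ('I_k -> R) -> L * 'I_nB * {set 'I_k})
  (a : nat -> 'I_nA) (t : nat -> R).

Definition elapse (mu : 'I_k -> R) (n : nat) : 'I_k -> R :=
  fun x => (mu x + (t n - prev t n))%R.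

(* controller state (l_n, mu_n) before answering the n-th move (0-indexed) *)
Fixpoint ctrl_state (n : nat) : L * ('I_k -> R) :=
  match n with
  | 0 => (l0, fun _ => 0%R)
  | n'.+1 =>
      let: (l, mu) := ctrl_state n' in
      let nu := elapse mu n' in
      let: (l', _, Y) := delta l (a n') nu in
      (l', fun x => if x \in Y then 0%R else nu x)
  end.

Definition ctrl_out (n : nat) : 'I_nB :=
  let: (l, mu) := ctrl_state n in (delta l (a n) (elapse mu n)).1.2.

End Controller.

Definition has_winning_controller (k m : nat) (I : instance) : Prop :=
  exists (L : finType) (l0 : L)
         (delta : L -> 'I_(i_nA I) -> ('I_k -> R) -> L * 'I_(i_nB I) * {set 'I_k}),
    region_invariant m delta /\
    forall (a : nat -> 'I_(i_nA I)) (t : nat -> R),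
      (forall n, (prev t n <= t n)%R) ->
      ~ in_lang (i_ta I)
          (fun n => ((a n, ctrl_out l0 delta a t n), t n) : ('I_(i_nA I) * 'I_(i_nB I)) * R).

(* Main.v *)
(** A controller only observes the region of its clocks, so it wins the timed game iff it
    wins a finite game: Player I plays a letter and a region of the controller clocks,
    Player II answers with a letter and a set of resets, and Player I wins iff some run of
    the automaton, over the regions of all clocks, fits the play and visits a final
    location infinitely often.  Recording the current time and the last reset times instead
    of the clock values, a region is determined by comparing differences of points with
    bounded integers, and it has a representative on a fixed finite integer grid.

    A winning finite-memory strategy is certified by ranks: for each memory state and each
    automaton state, a bound on the number of accepting letters still to come.  The memory
    can be bounded a priori: keep, as in Safra's construction, a list of sets of automaton
    states ordered by age, and always play as the state of the given controller that
    lexicographically minimises the maximal ranks of these sets.  Along an accepting run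
    the rank of some eventually stable set would decrease infinitely often.  Hence there is
    a winning controller iff there is a certificate below a computable bound, and being a
    certificate is expressed by a formula with bounded quantifiers only. *)

From Stdlib Require Import Classical ClassicalEpsilon ZArith Reals Lra.
From mathcomp Require Import all_boot zify.
Require Import Defs.

Set Implicit Arguments.
Unset Strict Implicit.
Unset Printing Implicit Defensive.
Delimit Scope R_scope with R.
Delimit Scope Z_scope with Z.

(** * Finite-memory strategies avoiding a Büchi condition *)

(** Player II does not see which run of the nondeterministic automaton is being followed, so one
    answer must serve all runs at once; this is why sets of automaton states have to be kept. The
    ranks read off a given controller depend on its memory, whose size the instance does not bound.
    They only decide which of its states is imitated; once the imitating strategy is known to win,
    with at most [(2 ^ #|Q|) ^ #|Q|] memory states, fresh ranks are computed for it, and these are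
    bounded by the number of pairs of a memory state and an automaton state. Epsilon-steps never
    have to lower a rank: only letters count, since an epsilon-cycle through a final location
    produces no infinite word. Grid vectors raise a difficulty of their own: a vector near the bound
    of the grid may leave no room for time to pass, so every step may first replace it by another
    vector of the same region. *)

Section Digits.
Variable B : nat.

(** The most significant digit comes first, so for digits below [B] the order of these numbers is
    the lexicographic order of words of length [i]. *)
Fixpoint num (d : nat -> nat) (i : nat) : nat :=
  if i is i'.+1 then num d i' * B + d i' else 0.

Lemma num_le (d e : nat -> nat) i :
  (forall j, j < i -> d j <= e j) -> num d i <= num e i.
Proof.
elim: i => //= i IH H; rewrite leq_add ?H //.
by rewrite leq_mul2r IH ?orbT // => j ji; apply: H; apply: leqW.
Qed.

Lemma eq_num (d e : nat -> nat) i :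
  (forall j, j < i -> d j = e j) -> num d i = num e i.
Proof.
elim: i => //= i IH H; rewrite H // IH // => j ji; apply: H; exact: leqW.
Qed.

Lemma num_prefix (d e : nat -> nat) i j :
  (forall j, e j < B) -> j <= i -> num d i <= num e i -> num d j <= num e j.
Proof.
move=> He; elim: i => [|i IH]; first by rewrite leqn0 => /eqP ->.
rewrite leq_eqVlt => /orP[/eqP -> //|]; rewrite ltnS => ji /= H.
by apply: IH => //; have := He i; nia.
Qed.

Lemma num_inj (d e : nat -> nat) i :
  (forall j, d j < B) -> (forall j, e j < B) ->
  num d i = num e i -> forall j, j < i -> d j = e j.
Proof.
move=> Hd He; elim: i => //= i IH H.
have [Hdi Hei] := (Hd i, He i).
have E : num d i = num e i by nia.
move=> j; rewrite ltnS leq_eqVlt => /orP[/eqP ->|]; last exact: IH.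
by move: H; rewrite E; lia.
Qed.

Lemma num_lt (d e : nat -> nat) i j :
  (forall j, d j < B) -> j <= i -> num d j < num e j -> num d i < num e i.
Proof.
move=> Hd; elim: i => [|i IH]; first by rewrite leqn0 => /eqP ->.
rewrite leq_eqVlt => /orP[/eqP -> //|]; rewrite ltnS => ji /= H.
by have := IH ji H; have := Hd i; nia.
Qed.

Lemma num_ge_tail (d e : nat -> nat) i j :
  (forall l, j <= l -> d l <= e l) -> j <= i -> num d j <= num e j -> num d i <= num e i.
Proof.
move=> Hd; elim: i => [|i IH]; first by rewrite leqn0 => /eqP ->.
rewrite leq_eqVlt => /orP[/eqP -> //|]; rewrite ltnS => ji /= H.
by have := IH ji H; have := Hd i ji; nia.
Qed.

Lemma num_bound (d : nat -> nat) i : (forall j, d j < B) -> num d i < B ^ i.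
Proof.
move=> H; elim: i => //= i IH; rewrite expnSr; have := H i; nia.
Qed.

Lemma num_head (d : nat -> nat) i :
  num d i.+1 = d 0 * B ^ i + num (fun j => d j.+1) i.
Proof.
elim: i => [|i IH]; first by rewrite /= expn0; lia.
by rewrite [LHS]/= -/(num d i.+1) IH /= expnSr; lia.
Qed.
End Digits.

(** * Eventually monotone sequences of natural numbers *)

Lemma nondec_stable (a : nat -> nat) b n0 :
  (forall n, n0 <= n -> a n <= a n.+1) -> (forall n, a n <= b) ->
  exists n1, n0 <= n1 /\ forall n, n1 <= n -> a n = a n1.
Proof.
move=> Hm Hb.
have: exists c, exists n1, n0 <= n1 /\ b - a n1 <= c by exists b, n0; split=> //; lia.
case=> c; elim: c => [|c IH] [n1 [H1 H2]].
  exists n1; split=> // n; elim: n => [|n IHn]; first by rewrite leqn0 => /eqP ->.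
  rewrite leq_eqVlt => /orP[/eqP -> //|]; rewrite ltnS => H.
  have := IHn H; have := Hm n (leq_trans H1 H); have := Hb n.+1; have := Hb n1; lia.
have [[n [Hn1 Hn2]]|Hno] := classic (exists n, n1 <= n /\ a n1 < a n).
  by apply: IH; exists n; split; [exact: leq_trans Hn1|have := Hb n; lia].
exists n1; split=> // n Hn.
have Hle : a n1 <= a n.
  elim: n Hn => [|n IHn]; first by rewrite leqn0 => /eqP ->.
  rewrite leq_eqVlt => /orP[/eqP -> //|]; rewrite ltnS => H.
  have := IHn H; have := Hm n (leq_trans H1 H); lia.
by apply/eqP; rewrite eqn_leq Hle andbT leqNgt; apply/negP => Hlt; apply: Hno; exists n.
Qed.

Lemma no_inf_descent (a : nat -> nat) n0 :
  (forall n, n0 <= n -> a n.+1 <= a n) ->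
  (forall N, exists n, N <= n /\ a n.+1 < a n) -> False.
Proof.
move=> Hm Hs.
have Hle n n' : n0 <= n -> n <= n' -> a n' <= a n.
  move=> Hn; elim: n' => [|n' IHn]; first by rewrite leqn0 => /eqP ->.
  rewrite leq_eqVlt => /orP[/eqP -> //|]; rewrite ltnS => H.
  have := IHn H; have := Hm n' (leq_trans Hn H); lia.
suff H c : forall n, n0 <= n -> a n <= c -> False by apply: (H (a n0) n0).
elim: c => [|c IH] n Hn Ha; have [n' [H1 H2]] := Hs n.
  by have := Hle _ _ Hn H1; lia.
by apply: (IH n'.+1); [lia|have := Hle _ _ Hn H1; lia].
Qed.

Lemma inf_often_least (P : nat -> nat -> Prop) b :
  (forall N, exists n, N <= n /\ exists2 i, i < b & P n i) ->
  exists i, i < b /\ (forall N, exists n, N <= n /\ P n i) /\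
    exists n0, forall n i', n0 <= n -> P n i' -> i <= i'.
Proof.
elim: b => [|b IH] H; first by have [n [_ []]] := H 0.
have [H'|H'] := classic (forall N, exists n, N <= n /\ exists2 i, i < b & P n i).
  by have [i [ib Hi]] := IH H'; exists i; split=> //; apply: leqW.
have [n0 Hn0] := not_all_ex_not _ _ H'.
have Hge n i' : n0 <= n -> P n i' -> b <= i'.
  by move=> Hn HP; rewrite leqNgt; apply/negP => Hi; apply: Hn0; exists n; split=> //; exists i'.
exists b; split=> //; split; last by exists n0.
move=> N; have [n [Hn [i ib HP]]] := H (maxn N n0).
exists n; split; first by apply: leq_trans Hn; apply: leq_maxl.
have := Hge n i (leq_trans (leq_maxr _ _) Hn) HP => bi.
by have -> : b = i by apply/eqP; rewrite eqn_leq bi -ltnS.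
Qed.

(** * Reachable cycles and the ranks that exclude them *)

Section Lasso.
Variables (V : finType) (init : pred V) (e0 e1 : rel V).
Let e := [rel x y | e0 x y || e1 x y].

Definition lasso :=
  exists x y z, [/\ init x, connect e x y, e1 y z & connect e z y].

Lemma lasso_path : lasso -> exists p : nat -> V,
  [/\ init (p 0), forall n, e (p n) (p n.+1) & forall N, exists n, N <= n /\ e1 (p n) (p n.+1)].
Proof.
case=> x [y [z [Hx /connectP[s1 p1 l1] Hyz /connectP[s2 p2 l2]]]].
pose c := z :: s2.
pose p n := if n <= size s1 then nth x (x :: s1) n
            else nth z c ((n - (size s1).+1) %% size c).
have Ps : p (size s1) = y by rewrite /p leqnn -(last_nth x) -l1.
have PS n : size s1 < n -> p n = nth z c ((n - (size s1).+1) %% size c).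
  by move=> H; rewrite /p leqNgt H.
have Pc j : p ((size s1).+1 + j * size c) = z.
  by rewrite PS ?ltn_addr // addKn modnMl.
have Pl j : p (size s1 + j * size c) = y.
  case: j => [|j]; first by rewrite mul0n addn0.
  have -> : size s1 + j.+1 * size c = (size s1).+1 + (j * size c + size s2).
    by rewrite mulSn /c /=; lia.
  rewrite PS ?ltn_addr // addKn modnMDl modn_small /c //= l2.
  by rewrite (last_nth z).
exists p; split=> //.
- move=> n; case: (ltngtP n (size s1)) => H.
  + rewrite /p (ltnW H) H; exact: (pathP x p1 n H).
  + rewrite !PS //; last exact: ltnW.
    set j := n - _; have -> : n.+1 - (size s1).+1 = j.+1 by rewrite /j; lia.
    rewrite -[j.+1]addn1 -modnDml addn1.
    have := ltn_pmod j (isT : 0 < size c); set i := j %% _ => Hi.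
    move: (Hi); rewrite leq_eqVlt => /orP[/eqP Ei|Hi'].
      rewrite Ei modnn /= [X in X || _]/=.
      have -> : nth z c i = y by rewrite l2 (last_nth z); move: Ei; rewrite /c /= => -[->].
      by rewrite Hyz orbT.
    rewrite (modn_small Hi'); have Hi2 : i < size s2 by move: Hi'; rewrite /c /= ltnS.
    exact: (pathP z p2 i Hi2).
  + rewrite H Ps PS //= subnn mod0n /= Hyz orbT //.
- move=> N; exists (size s1 + N * size c); split; first by rewrite /c /=; lia.
  by rewrite -addSn Pc Pl.
Qed.

(** Counts the sources of [e1]-edges still ahead. Without a lasso, a reachable source cannot be met
    again after its [e1]-edge is taken, so the count drops there; it never grows along an edge. *)
Definition rank v := #|[set u | connect e v u && [exists z, e1 u z]]|.

Lemma rank_le v v' : e v v' -> rank v' <= rank v.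
Proof.
move=> H; apply: subset_leq_card; apply/subsetP => u; rewrite !inE => /andP[Hu ->].
by rewrite andbT; apply: connect_trans Hu; apply: connect1.
Qed.

Lemma rank_lt v v' : ~ lasso -> [exists x, init x && connect e x v] ->
  e1 v v' -> rank v' < rank v.
Proof.
move=> nl /existsP[x /andP[ix cx]] H.
have He : e v v' by rewrite /= H orbT.
apply: proper_card; apply/properP; split.
  apply/subsetP => u; rewrite !inE => /andP[Hu ->].
  by rewrite andbT; apply: connect_trans Hu; apply: connect1.
exists v; rewrite !inE ?connect0 /=; first by apply/existsP; exists v'.
by apply/negP => /andP[Hc _]; apply: nl; exists x, v, v'.
Qed.

Lemma rank_max v : rank v <= #|V|.
Proof. exact: max_card. Qed.
End Lasso.

(** * Age-ordered lists of sets in the manner of Safra *)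

Section Safra.
Variable Q : finType.
Implicit Types (T U V : seq {set Q}) (q : Q) (S : {set Q}).

Definition member_bit T q (j : nat) : nat := q \in nth set0 T j.
Definition active T q := has (fun S => q \in S) T.
Definition later T q j := active (drop j.+1 T) q.
Definition nonempty : pred {set Q} := predC1 set0.

Lemma bit_lt T q j : member_bit T q j < 2.
Proof. by rewrite /member_bit; case: (_ \in _). Qed.

Lemma nth_set0_size T q j : q \in nth set0 T j -> j < size T.
Proof. by move=> H; rewrite ltnNge; apply/negP => h; move: H; rewrite nth_default ?inE. Qed.

Lemma activeP T q : reflect (exists j, q \in nth set0 T j) (active T q).
Proof.
apply: (iffP hasP) => [[S HS qS]|[j Hj]].
  by exists (index S T); rewrite nth_index.
by exists (nth set0 T j) => //; rewrite mem_nth // (nth_set0_size Hj).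
Qed.

Lemma laterP T q j : reflect (exists2 j', j < j' & q \in nth set0 T j') (later T q j).
Proof.
apply: (iffP (activeP _ _)) => [[i]|[j' Hj' H]].
  by rewrite nth_drop => H; exists (j.+1 + i) => //; rewrite leq_addr.
by exists (j' - j.+1); rewrite nth_drop subnKC.
Qed.

(* A state of the j-th set that also lies in a younger set has read an accepting letter
   since the j-th set was last green; counting it one higher makes the rank of the j-th
   set drop exactly when the set becomes green. *)
Definition node_rank T (rho : Q -> nat) j := \max_(q in nth set0 T j) (rho q + later T q j).

Lemma X_lt T rho b j : (forall q, rho q < b) -> node_rank T rho j < b.+1.
Proof.
move=> H; rewrite ltnS; apply/bigmax_leqP => q _.
by have := H q; case: (later _ _ _); lia.
Qed.

(** The dropped sets are empty, so no bit 1 is lost, and the remaining bits move to more significant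
    positions. *)
Lemma num_filter q V i :
  num 2 (member_bit V q) i <= num 2 (member_bit (filter nonempty V) q) i.
Proof.
elim: V i => [|S V IH] [|i] //.
rewrite [filter _ _]/=; case: ifP => HS.
  by rewrite !num_head leq_add2l; apply: IH.
rewrite num_head; move/negbFE/eqP: HS => ->; rewrite {1}/member_bit /= inE mul0n add0n.
by apply: (leq_trans (IH i)); lia.
Qed.

(** An empty set among the first [i + 1] would be dropped, shifting later bits up and bringing in a
    last bit 1; the number would then grow strictly. *)
Lemma num_filter_eq q V i :
  num 2 (member_bit V q) i.+1 = num 2 (member_bit (filter nonempty V) q) i.+1 ->
  q \in nth set0 (filter nonempty V) i ->
  i < size V /\ all nonempty (take i.+1 V).
Proof.
elim: V i => [|S V IH] i; first by rewrite nth_nil inE.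
rewrite [filter _ _]/=; case: ifP => HS.
  case: i => [|i]; first by rewrite /= HS take0.
  rewrite num_head [in RHS]num_head => /addnI H.
  by move/(IH i H) => [H1 H2]; rewrite ltnS /= HS.
rewrite num_head; move/negbFE/eqP: HS => ->; rewrite {1}/member_bit /= inE mul0n add0n.
move=> E Hq; have := num_filter q V i.
have Hb : member_bit (filter nonempty V) q i = 1 by rewrite /member_bit Hq.
by move: E => /=; rewrite Hb -/(member_bit V q) => -> ; lia.
Qed.

Lemma nth_filter_take V i j : i < size V -> all nonempty (take i.+1 V) -> j <= i ->
  nth set0 (filter nonempty V) j = nth set0 V j.
Proof.
move=> Hi Ha ji.
have -> : filter nonempty V = take i.+1 V ++ filter nonempty (drop i.+1 V).
  by rewrite -{1}(cat_take_drop i.+1 V) filter_cat (all_filterP Ha).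
by rewrite nth_cat size_takel // ltnS ji nth_take.
Qed.

Lemma active_filter V q : active (filter nonempty V) q = active V q.
Proof.
rewrite /active has_filter -filter_predI -has_filter; apply: eq_in_has => S _ /=.
by rewrite /nonempty /=; case: eqP => [->|_]; rewrite ?inE ?andbT.
Qed.

Lemma all_take_le (A : Type) (a : pred A) s i j : i <= j -> all a (take j s) -> all a (take i s).
Proof. by move=> ij; rewrite -{1}(subnKC ij) takeD all_cat => /andP[]. Qed.

Lemma later_filter_take V i j q : i < size V -> all nonempty (take i.+1 V) -> j <= i ->
  later (filter nonempty V) q j = later V q j.
Proof.
move=> Hi Ha ji; have Hj : all nonempty (take j.+1 V) by apply: all_take_le Ha.
rewrite /later -{1}(cat_take_drop j.+1 V) filter_cat (all_filterP Hj).
rewrite drop_size_cat ?active_filter // size_takel //; lia.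
Qed.

(* Green sets are those all of whose states lie in younger sets; their states are then
   removed from the younger sets. *)
Definition green U j := [forall q in nth set0 U j, later U q j].
Definition hit U q j := [exists j0 : 'I_j, green U j0 && (q \in nth set0 U j0)].
Definition tree_trunc U :=
  mkseq (fun j => [set q in nth set0 U j | ~~ hit U q j]) (size U).

Lemma hitP U q j :
  reflect (exists j0, [/\ j0 < j, green U j0 & q \in nth set0 U j0]) (hit U q j).
Proof.
apply: (iffP existsP) => [[j0 /andP[H1 H2]]|[j0 [H1 H2 H3]]]; first by exists j0.
by exists (Ordinal H1); rewrite /= H2.
Qed.

Lemma mem_trunc U q j : (q \in nth set0 (tree_trunc U) j) = (q \in nth set0 U j) && ~~ hit U q j.
Proof.
case: (ltnP j (size U)) => H; first by rewrite nth_mkseq // !inE.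
by rewrite !nth_default ?size_mkseq // inE.
Qed.

(** Asymmetric on purpose: the first argument is the older set, and a younger set is a descendant of
    it or apart from it. *)
Definition laminar : rel {set Q} := fun S S' => (S' \subset S) || [disjoint S & S'].

Definition tree_inv T := [&& pairwise laminar T, all nonempty T & size T <= #|Q|].

(** The own state of a set lies in no younger set, so every nonempty set strictly enlarges the union
    of the younger ones. *)
Lemma ownP T : (forall j, nth set0 T j != set0 ->
    exists2 q, q \in nth set0 T j & ~~ later T q j) ->
  size (filter nonempty T) <= #|\bigcup_(S <- T) S|.
Proof.
elim: T => [|S T IH] H //=.
have {}IH : size (filter nonempty T) <= #|\bigcup_(S <- T) S|.
  by apply: IH => j; apply: (H j.+1).
rewrite big_cons; case: ifP => [HS|_]; last first.
  by apply: leq_trans IH _; apply: subset_leq_card; apply: subsetUr.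
have [q /= qS] := H 0 HS; rewrite /later /= drop0 => Hq.
apply: leq_ltn_trans IH _; apply: proper_card; apply/properP; split; first exact: subsetUr.
exists q; first by rewrite inE qS.
apply/negP => Hin; move/negP: Hq; apply; move: Hin.
elim: T {H} => [|S' T IH]; first by rewrite big_nil inE.
by rewrite big_cons inE /= => /orP[->//|/IH ->]; rewrite orbT.
Qed.

Section Update.
Variable tr : Q -> bool -> Q -> bool.

(* Predecessors are compared lexicographically, oldest set first; an accepting letter
   counts as one more, youngest, set. *)
Definition cval T (c : Q * bool) := (num 2 (member_bit T c.1) (size T)).*2 + c.2.
Definition cand T q' (c : Q * bool) := active T c.1 && tr c.1 c.2 q'.
Definition best T q' : option (Q * bool) :=
  [pick c | cand T q' c && [forall c', cand T q' c' ==> (cval T c' <= cval T c)]].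

Lemma bestP T q' c : cand T q' c ->
  exists c0, [/\ best T q' = Some c0, cand T q' c0 & cval T c <= cval T c0].
Proof.
move=> Hc; rewrite /best; case: pickP => [c0 /andP[H1 /forallP H2]|H].
  by exists c0; split=> //; have /implyP := H2 c; apply.
have [c0 H1 H2] := @arg_maxnP _ c (cand T q') (cval T) Hc.
move: (H c0); rewrite H1 /=; move/negP; case; apply/forallP => c'; apply/implyP; exact: H2.
Qed.

Lemma best_cand T q' c : best T q' = Some c -> cand T q' c.
Proof. by rewrite /best; case: pickP => // c0 /andP[H _] [<-]. Qed.

(** Inheriting from one predecessor makes the old sets preimages under a partial function, which
    preserves laminarity; choosing the best predecessor makes the membership words monotone along
    every run. *)
Definition tree_succ T :=
  [seq [set q' | if best T q' is Some c then c.1 \in A else false] | A : {set Q} <- T] ++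
  [seq [set q'] | q' <- enum Q & if best T q' is Some c then c.2 else false].

Definition tree_step T := filter nonempty (tree_trunc (tree_succ T)).

Lemma size_pre T : size (tree_succ T) <= size T + #|Q|.
Proof.
rewrite size_cat !size_map leq_add2l size_filter.
by apply: leq_trans (count_size _ _) _; rewrite cardE.
Qed.

Lemma size_pre_ge T : size T <= size (tree_succ T).
Proof. by rewrite size_cat !size_map leq_addr. Qed.

Lemma mem_pre_old T q' j : j < size T ->
  (q' \in nth set0 (tree_succ T) j) = if best T q' is Some c then c.1 \in nth set0 T j else false.
Proof. by move=> H; rewrite nth_cat size_map H (nth_map set0) // inE. Qed.

Lemma mem_pre_new T q' j : size T <= j -> q' \in nth set0 (tree_succ T) j ->
  exists2 c, best T q' = Some c & c.2.
Proof.
move=> H Hq; have Hs := nth_set0_size Hq.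
move: Hq; rewrite nth_cat size_map ltnNge H /=.
set s := filter _ _; have Hj : j - size T < size s.
  by move: Hs; rewrite size_cat !size_map -/s; lia.
rewrite (nth_map q') // inE => /eqP E; have := mem_nth q' Hj; rewrite -E mem_filter.
by case: best => // c /andP[Hc _]; exists c.
Qed.

Lemma pre_fresh T q' c : best T q' = Some c -> c.2 ->
  exists j, [/\ size T <= j, j < size (tree_succ T) & q' \in nth set0 (tree_succ T) j].
Proof.
move=> Hb Hc; set s := [seq q' <- enum Q | if best T q' is Some c then c.2 else false].
have Hq : q' \in s by rewrite mem_filter Hb Hc mem_enum.
exists (size T + index q' s); rewrite leq_addr size_cat !size_map ltn_add2l index_mem Hq.
split=> //; rewrite nth_cat size_map ltnNge leq_addr /= addKn (nth_map q') ?index_mem //.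
by rewrite nth_index // inE.
Qed.

Lemma pre_laminar T : pairwise laminar T -> pairwise laminar (tree_succ T).
Proof.
have L1 S q : laminar S [set q].
  by rewrite /laminar sub1set disjoint_sym disjoints1; case: (q \in S).
move=> H; rewrite /tree_succ pairwise_cat; apply/and3P; split.
- by apply/allrelP => S S' _ /mapP[q _ ->].
- rewrite pairwise_map; apply: sub_pairwise H => S S' /orP[H|H]; apply/orP.
    left; apply/subsetP => q; rewrite !inE; case: best => // c; exact: (subsetP H).
  right; apply/pred0P => q /=; rewrite !inE; case: best => // c.
  by apply/negP => /andP[c1 c2]; move/pred0P: H => /(_ c.1) /=; rewrite c1 c2.
- rewrite pairwise_map; elim: (filter _ _) => //= a l ->; rewrite andbT.
  by apply/allP => b _ /=; apply: L1.
Qed.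

Lemma trunc_laminar U : pairwise laminar U -> pairwise laminar (tree_trunc U).
Proof.
move/(pairwiseP set0) => H; apply/(pairwiseP set0) => i j; rewrite !inE size_mkseq => Hi Hj ij.
have Hh q : hit U q i -> hit U q j.
  by case/hitP=> j0 [H1 H2 H3]; apply/hitP; exists j0; split=> //; apply: ltn_trans ij.
case/orP: (H i j Hi Hj ij) => L; apply/orP.
  left; apply/subsetP => q; rewrite !mem_trunc => /andP[Hq Hn].
  by rewrite (subsetP L) //=; apply: contra Hn; apply: Hh.
right; apply/pred0P => q /=; rewrite !mem_trunc; apply/negP => /andP[/andP[H1 _] /andP[H2 _]].
by move/pred0P: L => /(_ q) /=; rewrite H1 H2.
Qed.

Lemma upd_inv T : tree_inv T -> tree_inv (tree_step T).
Proof.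
case/and3P=> H1 H2 H3; have L := pre_laminar H1; apply/and3P; split.
- exact/pairwise_filter/trunc_laminar.
- exact: filter_all.
apply: leq_trans (ownP _) _; last exact: max_card.
(* An own state is needed for each surviving set: any state if the set was green, as it was just
   removed from all younger sets, and otherwise a state showing that it was not green. *)
move=> j /set0Pn[y]; rewrite mem_trunc => /andP[yj /negP nh].
case: (boolP (green (tree_succ T) j)) => Hg.
  exists y; first by rewrite mem_trunc yj; apply/negP.
  apply/laterP => -[j' jj']; rewrite mem_trunc => /andP[_ /hitP []].
  by exists j.
move: Hg; rewrite negb_forall => /existsP[q]; rewrite negb_imply => /andP[qj nl].
exists q; last first.
  by apply: contra nl => /laterP[j' jj']; rewrite mem_trunc => /andP[h _]; apply/laterP; exists j'.
rewrite mem_trunc qj; apply/hitP => -[j0 [h1 h2 h3]]; apply: nh; apply/hitP; exists j0; split=> //.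
(* If an older green set contained [q], laminarity would put the whole [j]-th set inside it, and [y]
   would have been removed as well. *)
have := pairwiseP set0 L j0 j; rewrite !inE (nth_set0_size h3) (nth_set0_size qj).
case/(_ isT isT h1)/orP => [/subsetP -> //|/pred0P /(_ q)].
by rewrite /= h3 qj.
Qed.

Lemma active_upd T q f q' : tree_inv T -> active T q -> tr q f q' -> active (tree_step T) q'.
Proof.
move=> HT Ha Ht; rewrite active_filter.
have /bestP[c [Hb Hc Hv]] : cand T q' (q, f) by rewrite /cand Ha.
have [j Hj] : exists j, q' \in nth set0 (tree_succ T) j.
  move: (Hc) => /andP[/activeP[j Hj] _]; exists j.
  by rewrite mem_pre_old ?Hb // (nth_set0_size Hj).
have Hex : exists j, q' \in nth set0 (tree_succ T) j by exists j.
(* The oldest set containing [q'] keeps it, since truncation only acts on sets younger than some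
   other set containing it. *)
case: (ex_minnP Hex) => i Hi Hm; apply/activeP; exists i; rewrite mem_trunc Hi.
by apply/hitP => -[j0 [h1 _ h3]]; have := Hm _ h3; lia.
Qed.

Lemma upd_active_pred T q' : active (tree_step T) q' ->
  exists q f, active T q /\ tr q f q'.
Proof.
rewrite active_filter => /activeP[j]; rewrite mem_trunc => /andP[Hj _].
have [c /best_cand /andP[H1 H2]] : exists c, best T q' = Some c.
  case: (ltnP j (size T)) => H; last by have [c Hc _] := mem_pre_new H Hj; exists c.
  by move: Hj; rewrite mem_pre_old //; case: best => // c _; exists c.
by exists c.1, c.2.
Qed.

(** [q'] inherits the word of its best predecessor, which is not below that of [q]; past [size T]
    the bits of [q] are all 0. *)
Lemma num_pre T q f q' i : active T q -> tr q f q' ->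
  num 2 (member_bit T q) i <= num 2 (member_bit (tree_succ T) q') i.
Proof.
move=> Ha Ht.
have /bestP[c [Hb Hc]] : cand T q' (q, f) by rewrite /cand Ha.
rewrite /cval /= => Hv.
have Hs : num 2 (member_bit T q) (size T) <= num 2 (member_bit T c.1) (size T).
  by move: Hv; case: f {Ht}; case: c.2; lia.
have E i' : i' <= size T -> num 2 (member_bit (tree_succ T) q') i' = num 2 (member_bit T c.1) i'.
  move=> Hi; apply: eq_num => j Hj; rewrite /member_bit mem_pre_old ?Hb //; exact: leq_trans Hi.
case: (leqP i (size T)) => Hi.
  by rewrite E //; apply: num_prefix Hi Hs => j; apply: bit_lt.
apply: (@num_ge_tail _ _ _ _ (size T)); [|exact: ltnW|by rewrite E].
by move=> l Hl; rewrite {1}/member_bit nth_default ?inE.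
Qed.

(** Either the best predecessor already has a larger word than [q], or it ties with [q] and must
    also read an accepting letter, so that [q'] receives a fresh singleton. *)
Lemma num_pre_lt T q q' i : active T q -> tr q true q' -> size (tree_succ T) <= i ->
  num 2 (member_bit T q) i < num 2 (member_bit (tree_succ T) q') i.
Proof.
move=> Ha Ht Hi.
have /bestP[c [Hb Hc]] : cand T q' (q, true) by rewrite /cand Ha.
rewrite /cval /= => Hv.
have Hle : size T <= i by apply: leq_trans (size_pre_ge _) Hi.
have E : num 2 (member_bit (tree_succ T) q') (size T) = num 2 (member_bit T c.1) (size T).
  by apply: eq_num => j Hj; rewrite /member_bit mem_pre_old ?Hb.
case: (ltnP (num 2 (member_bit T q) (size T)) (num 2 (member_bit T c.1) (size T))) => H.
  by apply: (@num_lt _ _ _ _ (size T)) => //; [move=> j; apply: bit_lt|rewrite E].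
have c2 : c.2 by move: Hv; case: c.2; lia.
have [j [H1 H2 H3]] := pre_fresh Hb c2.
apply: (@num_lt _ _ _ _ j.+1) => //=; [by move=> j'; apply: bit_lt|lia|].
have Hj0 : member_bit T q j = 0 by rewrite /member_bit nth_default ?inE.
have Hj1 : member_bit (tree_succ T) q' j = 1 by rewrite /member_bit H3.
by have := num_pre j Ha Ht; rewrite Hj0 Hj1; lia.
Qed.

Section Measure.
Variables (T : seq {set Q}) (rho rho' : Q -> nat).
Hypothesis Hrho : forall q f q', active T q -> tr q f q' -> rho' q' + f <= rho q.

(** The summand [later] can turn from 0 to 1 only through a fresh singleton; then an accepting
    letter was read and the drop of the rank pays for it. *)
Lemma X_pre j q' : j < size T -> q' \in nth set0 (tree_succ T) j ->
  rho' q' + later (tree_succ T) q' j <= node_rank T rho j.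
Proof.
move=> Hj; rewrite mem_pre_old //; case Hb: best => [c|//] Hc.
have /andP[Ha Ht] := best_cand Hb.
apply: leq_trans (leq_bigmax_cond _ Hc); have Hr := Hrho Ha Ht.
case: (boolP (later T c.1 j)) => Hl; first by case: later; lia.
case: laterP => [[j' jj' H]|]; last by lia.
case: (ltnP j' (size T)) => Hj'.
  move: H; rewrite mem_pre_old // Hb => H.
  by case/laterP: Hl; exists j'.
by have [c'] := mem_pre_new Hj' H; rewrite Hb => -[<-] c2; move: Hr; rewrite c2; lia.
Qed.

Lemma X_trunc j : j < size T -> node_rank (tree_trunc (tree_succ T)) rho' j <= node_rank T rho j.
Proof.
move=> Hj; apply/bigmax_leqP => q; rewrite mem_trunc => /andP[Hq _].
apply: leq_trans (X_pre Hj Hq); rewrite leq_add2l.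
case: laterP => // -[j' jj']; rewrite mem_trunc => /andP[H _].
by have -> : later (tree_succ T) q j by apply/laterP; exists j'.
Qed.

(** In a green set every state is counted one higher; truncation takes this unit away from all of
    them at once. A surviving state ensures that the old maximum is positive. *)
Lemma X_trunc_lt j : j < size T -> green (tree_succ T) j ->
  nonempty (nth set0 (tree_trunc (tree_succ T)) j) -> node_rank (tree_trunc (tree_succ T)) rho' j < node_rank T rho j.
Proof.
move=> Hj Hg /set0Pn[y yj].
have HX q : q \in nth set0 (tree_trunc (tree_succ T)) j -> rho' q + later (tree_trunc (tree_succ T)) q j < node_rank T rho j.
  rewrite mem_trunc => /andP[Hq _].
  have := X_pre Hj Hq; have := forallP Hg q; rewrite Hq /= => ->.
  case: laterP => [[j' jj']|]; last by lia.
  by rewrite mem_trunc => /andP[_ /hitP[]]; exists j.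
have X0 : 0 < node_rank T rho j by apply: leq_ltn_trans (HX _ yj).
by rewrite -(prednK X0) ltnS; apply/bigmax_leqP => q /HX; rewrite -{1}(prednK X0) ltnS.
Qed.
End Measure.
End Update.
End Safra.

(** * Contradiction along an accepting run *)

Section SafraRun.
Variable Q : finType.

Lemma nth_filter_count (V : seq {set Q}) g : nonempty (nth set0 V g) ->
  nth set0 (filter (@nonempty Q) V) (size (filter (@nonempty Q) (take g V))) = nth set0 V g /\
  size (filter (@nonempty Q) (take g V)) < size (filter (@nonempty Q) V).
Proof.
move=> H; have Hg : g < size V.
  by rewrite ltnNge; apply/negP => h; move: H; rewrite nth_default // /nonempty /= eqxx.
have E : filter (@nonempty Q) V = filter (@nonempty Q) (take g V) ++
    nth set0 V g :: filter (@nonempty Q) (drop g.+1 V).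
  by rewrite -{1}(cat_take_drop g V) filter_cat (drop_nth set0 Hg) /= H.
by rewrite E nth_cat ltnn subnn /= size_cat /= addnS ltnS leq_addr.
Qed.

(* Truncation of the bits of q' at the first green index g of the updated tree, whose
   index after compression is i. *)
Definition truncated (tr : Q -> bool -> Q -> bool) T q' i :=
  exists g, [/\ green (tree_succ tr T) g, q' \in nth set0 (tree_succ tr T) g, ~~ hit (tree_succ tr T) q' g &
    i = size (filter (@nonempty Q) (take g (tree_trunc (tree_succ tr T))))].

Section Step.
Variables (tr : Q -> bool -> Q -> bool) (T : seq {set Q}) (q q' : Q) (f : bool).
Hypotheses (HT : tree_inv T) (Ha : active T q) (Htr : tr q f q').

Lemma truncated_lt i : truncated tr T q' i ->
  [/\ i < #|Q| & q' \in nth set0 (tree_step tr T) i].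
Proof.
case=> g [H1 H2 H3 ->].
have HV : q' \in nth set0 (tree_trunc (tree_succ tr T)) g by rewrite mem_trunc H2.
have [|E Hlt] := @nth_filter_count (tree_trunc (tree_succ tr T)) g.
  by apply/set0Pn; exists q'.
rewrite /tree_step E; split=> //; apply: leq_trans Hlt _.
by have /and3P[] := upd_inv tr HT.
Qed.

(** Bits of [q'] are erased only strictly after the first green index containing it, and compression
    can only lower that index. *)
Lemma num_trunc i : (forall i', truncated tr T q' i' -> i <= i') ->
  num 2 (member_bit (tree_trunc (tree_succ tr T)) q') i.+1 = num 2 (member_bit (tree_succ tr T) q') i.+1.
Proof.
move=> H; apply: eq_num => j ji; rewrite /member_bit mem_trunc.
case: hitP => [[j0 [h1 h2 h3]]|]; last by rewrite andbT.
have Hex : exists j0, green (tree_succ tr T) j0 && (q' \in nth set0 (tree_succ tr T) j0).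
  by exists j0; rewrite h2.
case: (ex_minnP Hex) => g /andP[g1 g2] Hm.
have : i <= size (filter (@nonempty Q) (take g (tree_trunc (tree_succ tr T)))).
  apply: H; exists g; split=> //; apply/hitP => -[j1 [k1 k2 k3]].
  by have := Hm j1; rewrite k2 k3 => /(_ isT); lia.
have := count_size (@nonempty Q) (take g (tree_trunc (tree_succ tr T))); rewrite -size_filter.
have := Hm j0; rewrite h2 h3 => /(_ isT).
by have := geq_minl g (size (tree_trunc (tree_succ tr T))); rewrite -size_take_min; lia.
Qed.

Lemma num_upd i : (forall i', truncated tr T q' i' -> i <= i') ->
  num 2 (member_bit T q) i.+1 <= num 2 (member_bit (tree_step tr T) q') i.+1.
Proof.
move=> H; apply: leq_trans (num_filter _ _ _); rewrite num_trunc //.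
exact: num_pre Ha Htr.
Qed.

Lemma num_upd_lt N : (forall i', ~ truncated tr T q' i') -> f -> #|Q| + #|Q| <= N ->
  num 2 (member_bit T q) N.+1 < num 2 (member_bit (tree_step tr T) q') N.+1.
Proof.
move=> H Hf HN; apply: leq_trans (num_filter _ _ _); rewrite num_trunc; last by move=> i /H.
apply: num_pre_lt => //; first by move: Htr; rewrite Hf.
apply: leq_trans (size_pre _ _) _; case/and3P: HT => _ _ HTs; lia.
Qed.

Lemma stable_prefix i : (forall i', truncated tr T q' i' -> i <= i') ->
  num 2 (member_bit (tree_step tr T) q') i.+1 = num 2 (member_bit T q) i.+1 ->
  q \in nth set0 T i ->
  [/\ i < size T, i < size (tree_trunc (tree_succ tr T)) & all (@nonempty Q) (take i.+1 (tree_trunc (tree_succ tr T)))].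
Proof.
move=> H E Hq.
have H1 := num_pre i.+1 Ha Htr; have H2 := num_filter q' (tree_trunc (tree_succ tr T)) i.+1.
have H3 := num_trunc H.
have E2 : num 2 (member_bit (tree_trunc (tree_succ tr T)) q') i.+1 =
          num 2 (member_bit (filter (@nonempty Q) (tree_trunc (tree_succ tr T))) q') i.+1.
  by apply/eqP; rewrite eqn_leq H2 -/(tree_step tr T) E H3.
have Hq' : q' \in nth set0 (tree_step tr T) i.
  have := num_inj (bit_lt (tree_step tr T) q') (bit_lt T q) E (ltnSn i).
  by rewrite /member_bit Hq; case: (_ \in _).
have [h1 h2] := num_filter_eq E2 Hq'; split=> //; exact: nth_set0_size Hq.
Qed.

Lemma X_upd (rho rho' : Q -> nat) i :
  (forall q f q', active T q -> tr q f q' -> rho' q' + f <= rho q) ->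
  i < size T -> i < size (tree_trunc (tree_succ tr T)) -> all (@nonempty Q) (take i.+1 (tree_trunc (tree_succ tr T))) ->
  (forall j, j <= i -> node_rank (tree_step tr T) rho' j <= node_rank T rho j) /\
  (truncated tr T q' i -> node_rank (tree_step tr T) rho' i < node_rank T rho i).
Proof.
move=> Hr Hi Hs Hall.
have E j : j <= i -> node_rank (tree_step tr T) rho' j = node_rank (tree_trunc (tree_succ tr T)) rho' j.
  move=> ji; rewrite /node_rank (nth_filter_take Hs Hall ji); apply: eq_bigr => p _.
  by rewrite (later_filter_take _ Hs Hall ji).
split=> [j ji|]; first by rewrite E //; apply: X_trunc => //; lia.
case=> g [H1 H2 H3 Ei].
(* The first [i + 1] sets are nonempty, so compression does not move them and the green index sent
   to [i] is [i] itself. *)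
have gi : g = i.
  have ig : i <= g.
    rewrite {1}Ei size_filter; apply: leq_trans (count_size _ _) _.
    by rewrite size_take_min geq_minl.
  apply/eqP; rewrite eqn_leq ig andbT leqNgt; apply/negP => lt.
  have Hpos : forall t : seq {set Q}, i < size t -> all (@nonempty Q) (take i.+1 t) ->
      i < g -> i < size (filter (@nonempty Q) (take g t)).
    move=> t ht Ha' lt'; rewrite -(subnKC lt') takeD filter_cat (all_filterP Ha') size_cat.
    by rewrite size_takel //; lia.
  by have := Hpos _ Hs Hall lt; rewrite -Ei ltnn.
rewrite E // X_trunc_lt //; first by rewrite -gi.
apply/set0Pn; exists q'; rewrite mem_trunc -gi; exact/andP.
Qed.
End Step.

(** Here [rho n] stands for the ranks at the controller state selected at time [n], and [rho' n] for
    those at its successor before the next selection; the last hypothesis says that a new selection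
    never increases the lexicographic value. *)
Theorem safra_run (tr : nat -> Q -> bool -> Q -> bool) (T : nat -> seq {set Q})
    (q : nat -> Q) (f : nat -> bool) (rho rho' : nat -> Q -> nat) b :
  tree_inv (T 0) -> (forall n, T n.+1 = tree_step (tr n) (T n)) ->
  active (T 0) (q 0) -> (forall n, tr n (q n) (f n) (q n.+1)) ->
  (forall N, exists n, N <= n /\ f n) ->
  (forall n p, rho n p < b) -> (forall n p, rho' n p < b) ->
  (forall n p c p', active (T n) p -> tr n p c p' -> rho' n p' + c <= rho n p) ->
  (forall n, num b.+1 (node_rank (T n.+1) (rho n.+1)) #|Q| <= num b.+1 (node_rank (T n.+1) (rho' n)) #|Q|) ->
  False.
Proof.
move=> I0 HT A0 Htr Hf Hb Hb' Hrho Hmin.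
have HI n : tree_inv (T n) by elim: n => // n IH; rewrite HT upd_inv.
have HA n : active (T n) (q n).
  by elim: n => // n IH; rewrite HT (active_upd (HI n) IH (Htr n)).
pose P n i := truncated (tr n) (T n) (q n.+1) i.
(* Without truncation from [N] on, the membership word of the run would never decrease and would
   grow at each accepting letter, although it is bounded. *)
have Hinf N : exists n, N <= n /\ exists2 i, i < #|Q| & P n i.
  apply: NNPP => Hno.
  have Hn n i : N <= n -> ~ P n i.
    move=> hn hP; apply: Hno; exists n; split=> //; exists i => //.
    by have [] := truncated_lt (HI n) hP.
  pose a n := num 2 (member_bit (T n) (q n)) (#|Q| + #|Q|).+1.
  have Ha n : N <= n -> a n <= a n.+1.
    move=> hn; rewrite /a HT; refine (num_upd (HI n) (HA n) (Htr n) _) => i' hP; by case: (Hn n i' hn hP).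
  have Hbd n : a n <= 2 ^ (#|Q| + #|Q|).+1.
    by apply: ltnW; apply: num_bound; apply: bit_lt.
  have [n1 [H1 H2]] := nondec_stable Ha Hbd.
  have [n [H3 H4]] := Hf n1.
  have : a n < a n.+1.
    rewrite /a HT; refine (num_upd_lt (HI n) (HA n) (Htr n) _ H4 (leqnn _)) => i'.
    by apply: Hn; lia.
  by rewrite (H2 n) // (H2 n.+1) ?ltnn //; lia.
have [i [iQ [Hi [n0 Hn0]]]] := inf_often_least Hinf.
(* With [i] the least position truncated infinitely often, the prefix up to [i] is eventually
   constant, so position [i] then denotes one and the same set, containing the run. *)
pose a n := num 2 (member_bit (T n) (q n)) i.+1.
have Ha n : n0 <= n -> a n <= a n.+1.
  move=> hn; rewrite /a HT; refine (num_upd (HI n) (HA n) (Htr n) _) => i'; exact: Hn0.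
have Hbd n : a n <= 2 ^ i.+1 by apply: ltnW; apply: num_bound; apply: bit_lt.
have [n1 [H1 H2]] := nondec_stable Ha Hbd.
have Hq n : n1 <= n -> q n \in nth set0 (T n) i.
  move=> hn; have [n2 [h1 h2]] := Hi n1.
  have [_] := truncated_lt (HI n2) h2; rewrite -HT => hq.
  have E : a n = a n2.+1 by rewrite (H2 n) // (H2 n2.+1) //; lia.
  have := num_inj (bit_lt (T n) (q n)) (bit_lt _ _) E (ltnSn i).
  by rewrite /member_bit hq; case: (_ \in _).
have Hst n : n1 <= n ->
    (forall j, j <= i -> node_rank (T n.+1) (rho' n) j <= node_rank (T n) (rho n) j) /\
    (P n i -> node_rank (T n.+1) (rho' n) i < node_rank (T n) (rho n) i).
  move=> hn.
  have [||h1 h2 h3] := @stable_prefix (tr n) (T n) (q n) (q n.+1) (f n) (HI n) (HA n) (Htr n) i _ _ (Hq n hn).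
  - by move=> i'; apply: Hn0; lia.
  - by rewrite -HT -/(a n) -/(a n.+1) (H2 n) // (H2 n.+1) //; lia.
  by rewrite HT; apply: (X_upd (HI n) (HA n) (Htr n) (Hrho n) h1 h2 h3).
(* Only ranks up to position [i] are compared: older sets do not increase, the [i]-th drops at each
   truncation, and a lexicographic minimum does not increase prefixes. *)
pose w n := num b.+1 (node_rank (T n) (rho n)) i.+1.
have Hw n : w n.+1 <= num b.+1 (node_rank (T n.+1) (rho' n)) i.+1.
  by apply: (num_prefix _ iQ (Hmin n)) => j; apply: X_lt.
apply: (@no_inf_descent w n1) => [n hn|N].
  apply: leq_trans (Hw n) _; apply: num_le => j; rewrite ltnS; exact: (proj1 (Hst n hn)).
have [n [h1 h2]] := Hi (maxn N n1).
exists n; split; first by lia.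
have hn : n1 <= n by lia.
apply: leq_ltn_trans (Hw n) _; have [k1 k2] := Hst n hn.
rewrite /w /=; have := k2 h2.
have : num b.+1 (node_rank (T n.+1) (rho' n)) i <= num b.+1 (node_rank (T n) (rho n)) i.
  by apply: num_le => j ji; apply: k1; lia.
nia.
Qed.
End SafraRun.

(** * Reducing the memory of a winning strategy *)

Section Game.
Variables (Q In Out : finType) (init : pred Q) (eps : rel Q).
Variable lett : In -> Out -> Q -> bool -> Q -> bool.

Section Strategy.
Variables (L : finType) (l0 : L) (out : L -> In -> Out) (nxt : L -> In -> L).

Definition gletter f : rel (L * Q) := fun v v' =>
  [exists i, (v'.1 == nxt v.1 i) && lett i (out v.1 i) v.2 f v'.2].
Definition gplain : rel (L * Q) := fun v v' =>
  ((v.1 == v'.1) && eps v.2 v'.2) || gletter false v v'.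
Definition ginit : pred (L * Q) := fun v => (v.1 == l0) && init v.2.
Definition winning := ~ lasso ginit gplain (gletter true).

Definition gedge := [rel x y | gplain x y || gletter true x y].
Definition reach v := [exists x, ginit x && connect gedge x v].
Definition grank v := rank gplain (gletter true) v.

Lemma reach_edge v v' : gedge v v' -> reach v -> reach v'.
Proof.
move=> H /existsP[x /andP[H1 H2]]; apply/existsP; exists x; rewrite H1 /=.
by apply: connect_trans H2 _; apply: connect1.
Qed.

Lemma eps_edge l q q' : eps q q' -> gedge (l, q) (l, q').
Proof. by move=> H; rewrite /= /gplain /= eqxx H. Qed.

Lemma letter_edge l i q f q' : lett i (out l i) q f q' -> gletter f (l, q) (nxt l i, q').
Proof. by move=> H; apply/existsP; exists i; rewrite /= eqxx. Qed.

Lemma grank_letter l i q f q' : winning -> reach (l, q) -> lett i (out l i) q f q' ->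
  reach (nxt l i, q') /\ grank (nxt l i, q') + f <= grank (l, q).
Proof.
move=> Hw Hr /letter_edge H.
have He : gedge (l, q) (nxt l i, q') by move: H; case: f => H; rewrite /= /gplain H ?orbT.
split; first exact: (reach_edge He Hr).
case: f H => H; first by rewrite addn1; apply: (rank_lt Hw Hr H).
by rewrite addn0; apply: rank_le.
Qed.

(** Ranks are shifted by one to keep 0 for unreachable pairs; the positive entries thus form an
    inductive invariant with a ranking on it. *)
Theorem certificate_of_winning : winning -> exists rk : L -> Q -> nat,
  [/\ forall l q, rk l q <= (#|L| * #|Q|).+1,
      forall q, init q -> 0 < rk l0 q,
      forall l q q', eps q q' -> 0 < rk l q -> 0 < rk l q' <= rk l q &
      forall l i, exists o l', forall q f q', lett i o q f q' -> 0 < rk l q ->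
        0 < rk l' q' /\ rk l' q' + f <= rk l q].
Proof.
move=> Hw; exists (fun l q => if reach (l, q) then (grank (l, q)).+1 else 0); split.
- move=> l q; case: ifP => // _; rewrite ltnS -card_prod; exact: rank_max.
- move=> q Hq; rewrite ifT //; apply/existsP; exists (l0, q).
  by rewrite /ginit /= eqxx Hq connect0.
- move=> l q q' /(eps_edge l) He; case: ifP => // Hr _.
  by rewrite (reach_edge He Hr) ltnS /=; apply: rank_le.
- move=> l i; exists (out l i), (nxt l i) => q f q' Hl; case: ifP => // Hr _.
  by have [-> H] := grank_letter Hw Hr Hl; rewrite addSn ltnS.
Qed.
End Strategy.

(** Epsilon-steps are absorbed into the next letter, so that the list of sets is updated once per
    letter. *)
Definition comp_letter i o q f q' := [exists q1, connect eps q q1 && lett i o q1 f q'].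

Section Reduce.
Variables (L : finType) (l0 : L) (out : L -> In -> Out) (nxt : L -> In -> L).
Hypothesis Hw : winning l0 out nxt.

(** Lists of at most [#|Q|] nonempty sets, padded with empty sets to get a finite type whose
    cardinality is easily computed. *)
Definition tree_memory := {ffun 'I_#|Q| -> {set Q}}.
Definition tree_of (mu : tree_memory) : seq {set Q} := filter (@nonempty Q) (map mu (enum 'I_#|Q|)).
Definition mem_of (T : seq {set Q}) : tree_memory := [ffun i : 'I_#|Q| => nth set0 T i].

Lemma mem_ofK T : tree_inv T -> tree_of (mem_of T) = T.
Proof.
case/and3P=> _ Hne Hs; rewrite /tree_of.
have -> : map (mem_of T) (enum 'I_#|Q|) = mkseq (nth set0 T) #|Q|.
  rewrite /mkseq -val_enum_ord -map_comp; apply: eq_map => i /=; by rewrite ffunE.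
rewrite -(subnKC Hs) /mkseq iotaD map_cat filter_cat -/(mkseq _ _) mkseq_nth (all_filterP Hne).
rewrite add0n (_ : filter _ _ = [::]) ?cats0 //; apply/eqP; rewrite -[_ == _]negbK -has_filter.
apply/hasPn => A /mapP[i]; rewrite mem_iota => /andP[Hi _] ->.
by rewrite nth_default // negbK.
Qed.

Notation rho := (fun l q => grank out nxt (l, q)).
(** Ranks are known to drop at accepting letters only on reachable pairs, so only such states may be
    imitated. *)
Definition compat T l := [forall q, active T q ==> reach l0 out nxt (l, q)].
Definition weight T l := num (#|L| * #|Q|).+2 (node_rank T (rho l)) #|Q|.
Definition sel (mu : tree_memory) : L :=
  if [pick l | compat (tree_of mu) l] is Some l1
  then [arg min_(l < l1 | compat (tree_of mu) l) weight (tree_of mu) l] else l0.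

Lemma selP mu l : compat (tree_of mu) l ->
  compat (tree_of mu) (sel mu) /\ weight (tree_of mu) (sel mu) <= weight (tree_of mu) l.
Proof.
move=> H; rewrite /sel; case: pickP => [l1 H1|/(_ l)]; last by rewrite H.
by case: arg_minnP => // l2 H2 Hm; split=> //; apply: Hm.
Qed.

Definition mout mu i := out (sel mu) i.
Definition mnxt mu i := mem_of (tree_step (comp_letter i (mout mu i)) (tree_of mu)).
Definition tree0 := filter (@nonempty Q) [:: [set q | init q]].
Definition memory0 := mem_of tree0.

Lemma rho_comp l i q f q' : reach l0 out nxt (l, q) -> comp_letter i (out l i) q f q' ->
  reach l0 out nxt (nxt l i, q') /\ rho (nxt l i) q' + f <= rho l q.
Proof.
move=> Hr /existsP[q1 /andP[Hc Hl]].
have [Hr1 Hle] : reach l0 out nxt (l, q1) /\ rho l q1 <= rho l q.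
  case/connectP: Hc Hr => p Hp -> {q1 Hl}; elim: p q Hp => [|a p IH] q /=; first by [].
  case/andP=> /(eps_edge out nxt l) He Hp Hr.
  have [H1 H2] := IH _ Hp (reach_edge He Hr); split=> //; apply: leq_trans H2 _.
  exact: rank_le.
have [H1 H2] := grank_letter Hw Hr1 Hl; split=> //; exact: leq_trans Hle.
Qed.

Definition gcomp f : rel (tree_memory * Q) := fun v v' =>
  [exists i, (v'.1 == mnxt v.1 i) && comp_letter i (mout v.1 i) v.2 f v'.2].

Lemma inv_T0 : tree_inv tree0.
Proof.
rewrite /tree0 /= /tree_inv; case: ifP => // H; rewrite /= H /=.
by move: H; rewrite /nonempty /= => /set0Pn[q _]; rewrite (cardD1 q).
Qed.

Lemma comp_no_lasso : ~ lasso (ginit memory0) (gcomp false) (gcomp true).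
Proof.
case/lasso_path => p [P0 Pe Pi].
pose f n := gcomp true (p n) (p n.+1).
have He n : gcomp (f n) (p n) (p n.+1).
  by have := Pe n; rewrite /= /f; case E: (gcomp true _ _) => //; rewrite orbF.
pose i n := xchoose (existsP (He n)).
have Hi n : ((p n.+1).1 == mnxt (p n).1 (i n)) &&
    comp_letter (i n) (mout (p n).1 (i n)) (p n).2 (f n) (p n.+1).2.
  exact: (xchooseP (existsP (He n))).
pose T n := tree_of (p n).1.
case/andP: P0 => /eqP E0 I0.
have ET0 : T 0 = tree0 by rewrite /T E0 /memory0 mem_ofK ?inv_T0.
have HT n : tree_inv (T n) ->
    T n.+1 = tree_step (comp_letter (i n) (mout (p n).1 (i n))) (T n).
  by move=> H; have /andP[/eqP E _] := Hi n; rewrite /T E /mnxt mem_ofK //; apply: upd_inv.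
have HI n : tree_inv (T n).
  by elim: n => [|n IH]; [rewrite ET0 inv_T0|rewrite HT // upd_inv].
pose l n := sel (p n).1.
have C0 : compat (T 0) l0.
  apply/forallP => q; apply/implyP; rewrite ET0 active_filter /active /= orbF inE => Hq.
  by apply/existsP; exists (l0, q); rewrite /ginit /= eqxx Hq connect0.
(* The successor of the imitated state remains a candidate for the next selection, so the minimum
   has at most its weight. *)
have CS n : compat (T n) (l n) -> compat (T n.+1) (nxt (l n) (i n)).
  move=> /forallP H; apply/forallP => q'; apply/implyP; rewrite HT // => Ha.
  have [q [c [H1 H2]]] := upd_active_pred Ha.
  by have := H q; rewrite H1 /= => Hr; have [] := rho_comp Hr H2.
have HC n : compat (T n) (l n).
  elim: n => [|n IH]; first by have [] := selP C0.
  by have [] := selP (CS n IH).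
have Hb l' q : rho l' q < (#|L| * #|Q|).+1 by rewrite ltnS -card_prod; apply: rank_max.
apply: (@safra_run Q (fun n => comp_letter (i n) (mout (p n).1 (i n))) T (fun n => (p n).2) f
  (fun n => rho (l n)) (fun n => rho (nxt (l n) (i n))) (#|L| * #|Q|).+1 (HI 0)) => //.
- by move=> n; apply: HT.
- by rewrite ET0 active_filter /active /= inE I0.
- by move=> n; have /andP[] := Hi n.
- by move=> n q c q' Ha Hc; have /forallP/(_ q) := HC n; rewrite Ha /= => Hr; have [] := rho_comp Hr Hc.
- by move=> n; have [_] := selP (CS n (HC n)).
Qed.

(** The path is cut after its last letter; the epsilon-steps that follow stay pending until the next
    one. *)
Lemma comp_connect v u : connect (gedge mout mnxt) v u ->
  exists2 v', connect [rel x y | gcomp false x y || gcomp true x y] v v' &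
    v'.1 = u.1 /\ connect eps v'.2 u.2.
Proof.
case/connectP=> p; elim/last_ind: p u => [|p a IH] u /=.
  by move=> _ ->; exists v; rewrite ?connect0.
rewrite rcons_path last_rcons => /andP[/IH /(_ erefl) [v' H1 [H2 H3]] He] ->.
move: He; set w := last _ _ in H2 H3 *.
have HL c : gletter mout mnxt c w a -> exists2 v'',
   connect [rel x y | gcomp false x y || gcomp true x y] v v'' &
    v''.1 = a.1 /\ connect eps v''.2 a.2.
  case/existsP=> i /andP[E Hl]; exists a; last by rewrite connect0.
  apply: connect_trans H1 _; apply: connect1.
  have : gcomp c v' a.
    apply/existsP; exists i; rewrite H2 E /=; apply/existsP; exists w.2; by rewrite H3.
  by case: c {Hl} => /= ->; rewrite ?orbT.
case/orP; last exact: HL; case/orP; last exact: HL.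
case/andP=> /eqP E Ha; exists v' => //; rewrite H2 E; split=> //.
by apply: connect_trans H3 _; apply: connect1.
Qed.

Lemma reduced_winning : winning memory0 mout mnxt.
Proof.
case=> x [y [z [Hx Hxy Hyz Hzy]]]; apply: comp_no_lasso.
have Hto y' : y'.1 = y.1 -> connect eps y'.2 y.2 -> gcomp true y' z.
  move=> E Hc; case/existsP: Hyz => i /andP[H1 H2]; apply/existsP; exists i.
  by rewrite E H1 /=; apply/existsP; exists y.2; rewrite Hc.
have [y1 Hxy1 [E1 C1]] := comp_connect Hxy.
have [y2 Hzy2 [E2 C2]] := comp_connect Hzy.
exists x, y2, z; split=> //; last exact: Hto.
apply: connect_trans Hxy1 _; apply: connect_trans Hzy2; apply: connect1.
by rewrite /= (Hto y1) ?orbT.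
Qed.
End Reduce.

Theorem bounded_certificate (L : finType) (l0 : L) (out : L -> In -> Out) (nxt : L -> In -> L) :
  winning l0 out nxt ->
  exists (H := (2 ^ #|Q|) ^ #|Q|) (rk : 'I_H -> Q -> nat) (p0 : 'I_H),
  [/\ forall p q, rk p q <= (H * #|Q|).+1,
      forall q, init q -> 0 < rk p0 q,
      forall p q q', eps q q' -> 0 < rk p q -> 0 < rk p q' <= rk p q &
      forall p i, exists o p', forall q f q', lett i o q f q' -> 0 < rk p q ->
        0 < rk p' q' /\ rk p' q' + f <= rk p q].
Proof.
move=> Hw; have [rk [H1 H2 H3 H4]] := certificate_of_winning (reduced_winning Hw).
move=> H.
have EH : #|tree_memory| = H by rewrite card_ffun card_ord -cardsT -powersetT card_powerset cardsT.
pose h (p : 'I_H) : tree_memory := enum_val (cast_ord (esym EH) p).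
pose g (u : tree_memory) : 'I_H := cast_ord EH (enum_rank u).
have hg u : h (g u) = u by rewrite /h /g cast_ordK enum_rankK.
exists (fun p => rk (h p)), (g memory0); split.
- by move=> p q; rewrite -EH; apply: H1.
- by move=> q; rewrite hg; apply: H2.
- by move=> p; apply: H3.
- by move=> p i; have [o [u Hu]] := H4 (h p) i; exists o, (g u); rewrite hg.
Qed.
End Game.

(** * Computable functions and decidable predicates *)

Fixpoint unpair (n : nat) : nat * nat :=
  if n is n'.+1 then
    let: (a, b) := unpair n' in if a is a'.+1 then (a', b.+1) else (b.+1, 0)
  else (0, 0).
Definition p1 n := (unpair n).1.
Definition p2 n := (unpair n).2.

Lemma double_triangle s : ((s * s.+1)./2).*2 = s * s.+1.
Proof. by rewrite -[RHS]odd_double_half oddM /= andbN. Qed.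

Lemma unpairK n : cpair (unpair n).1 (unpair n).2 = n.
Proof.
elim: n => [|n] //=; case: (unpair n) => [[|a] b] /= <-; rewrite /cpair.
  have := double_triangle (0 + b); have := double_triangle (b.+1 + 0); nia.
by rewrite addSnnS addnS.
Qed.

Lemma cpair_inj a b a' b' : cpair a b = cpair a' b' -> a = a' /\ b = b'.
Proof.
rewrite /cpair; have := double_triangle (a + b); have := double_triangle (a' + b').
move=> H1 H2 H3.
have Es : a + b = a' + b'.
  by case: (ltngtP (a + b) (a' + b')) => // H; nia.
by split; move: H3 H1 H2; rewrite Es; lia.
Qed.

Lemma unpair_cpair a b : unpair (cpair a b) = (a, b).
Proof. by have := @cpair_inj _ _ _ _ (unpairK (cpair a b)); case: unpair => ? ? [/= -> ->]. Qed.

Lemma p1E a b : p1 (cpair a b) = a. Proof. by rewrite /p1 unpair_cpair. Qed.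
Lemma p2E a b : p2 (cpair a b) = b. Proof. by rewrite /p2 unpair_cpair. Qed.
Lemma cpairE n : cpair (p1 n) (p2 n) = n. Proof. exact: unpairK. Qed.

Lemma cpair_gel a b : a <= cpair a b.
Proof. by rewrite /cpair; have := double_triangle (a + b); nia. Qed.
Lemma cpair_ger a b : b <= cpair a b.
Proof. exact: leq_addl. Qed.
Lemma cpair_le a b y : cpair a b <= y -> a <= y /\ b <= y.
Proof. by move=> h; split; apply: leq_trans h; [apply: cpair_gel|apply: cpair_ger]. Qed.
Lemma cpair_gtr a b : 0 < a -> b < cpair a b.
Proof. by rewrite /cpair; have := double_triangle (a + b); nia. Qed.

(** * Closure properties of computable functions and decidable predicates *)

Definition computable (f : nat -> nat) := exists c, forall n, eval c n (f n).
Definition decidable_pred (P : nat -> Prop) :=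
  exists f, computable f /\ forall n, (P n /\ f n = 1) \/ (~ P n /\ f n = 0).

Lemma comp_ext f g : (forall n, f n = g n) -> computable f -> computable g.
Proof. by move=> E [c Hc]; exists c => n; rewrite -E. Qed.

Lemma comp_p1 : computable p1.
Proof. by exists CFst => n; rewrite -{1}(cpairE n); constructor. Qed.
Lemma comp_p2 : computable p2.
Proof. by exists CSnd => n; rewrite -{1}(cpairE n); constructor. Qed.
Lemma comp_comp f g : computable f -> computable g -> computable (fun z => f (g z)).
Proof. by move=> [c Hc] [d Hd]; exists (CComp c d) => n; econstructor; eauto. Qed.
Lemma comp_pair f g : computable f -> computable g -> computable (fun z => cpair (f z) (g z)).
Proof. by move=> [c Hc] [d Hd]; exists (CPair c d) => n; constructor. Qed.
Lemma comp_id : computable (fun z => z).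
Proof. by apply: comp_ext (comp_pair comp_p1 comp_p2) => n; apply: cpairE. Qed.
Lemma comp_S f : computable f -> computable (fun z => (f z).+1).
Proof. by move=> [c Hc]; exists (CComp CSucc c) => n; econstructor; eauto; constructor. Qed.
Lemma comp_const k : computable (fun _ => k).
Proof. by elim: k => [|k IH]; [exists CZero => n; constructor|apply: comp_S]. Qed.

Lemma comp_p1' f : computable f -> computable (fun z => p1 (f z)).
Proof. exact: comp_comp comp_p1. Qed.
Lemma comp_p2' f : computable f -> computable (fun z => p2 (f z)).
Proof. exact: comp_comp comp_p2. Qed.

Fixpoint prec (a : nat) (g : nat -> nat -> nat) (n : nat) : nat :=
  if n is n'.+1 then g n' (prec a g n') else a.

Lemma comp_prec (f : nat -> nat) (g : nat -> nat -> nat -> nat) (h : nat -> nat) :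
  computable f -> computable (fun z => g (p1 z) (p1 (p2 z)) (p2 (p2 z))) -> computable h ->
  computable (fun z => prec (f z) (g z) (h z)).
Proof.
move=> [c Hc] [d Hd] Hh.
have [r Hr] : computable (fun z => prec (f (p1 z)) (g (p1 z)) (p2 z)).
  exists (CRec c d) => z; rewrite -{1}(cpairE z); elim: (p2 z) => [|n IH] /=.
    by constructor.
  econstructor; first exact: IH.
  by have := Hd (cpair (p1 z) (cpair n (prec (f (p1 z)) (g (p1 z)) n))); rewrite !(p1E, p2E).
apply: comp_ext (comp_comp (ex_intro _ r Hr) (comp_pair comp_id Hh)) => n.
by rewrite p1E p2E.
Qed.

Lemma comp_pred f : computable f -> computable (fun z => (f z).-1).
Proof.
move=> Hf; have H : computable (fun z => prec 0 (fun n _ => n) (f z)).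
  apply: (@comp_prec (fun _ => 0) (fun _ n _ => n)) => //; first exact: comp_const.
  exact: comp_p1' comp_p2.
by apply: comp_ext H => n; case: (f n).
Qed.

Lemma comp_add f g : computable f -> computable g -> computable (fun z => f z + g z).
Proof.
move=> Hf Hg; have H : computable (fun z => prec (f z) (fun _ r => r.+1) (g z)).
  apply: (@comp_prec f (fun _ _ r => r.+1)) => //.
  exact: comp_S (comp_p2' comp_p2).
by apply: comp_ext H => n; elim: (g n) => /= [|k ->]; rewrite ?addn0 ?addnS.
Qed.

Lemma comp_mul f g : computable f -> computable g -> computable (fun z => f z * g z).
Proof.
move=> Hf Hg; have H : computable (fun z => prec 0 (fun _ r => r + f z) (g z)).
  apply: (@comp_prec (fun _ => 0) (fun z _ r => r + f z)) => //; first exact: comp_const.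
  exact: comp_add (comp_p2' comp_p2) (comp_comp Hf comp_p1).
by apply: comp_ext H => n; elim: (g n) => /= [|k ->]; rewrite ?muln0 ?mulnS // addnC.
Qed.

Lemma comp_sub f g : computable f -> computable g -> computable (fun z => f z - g z).
Proof.
move=> Hf Hg; have H : computable (fun z => prec (f z) (fun _ r => r.-1) (g z)).
  apply: (@comp_prec f (fun _ _ r => r.-1)) => //.
  exact: comp_pred (comp_p2' comp_p2).
by apply: comp_ext H => n; elim: (g n) => /= [|k ->]; rewrite ?subn0 ?subnS.
Qed.

Lemma comp_exp f g : computable f -> computable g -> computable (fun z => f z ^ g z).
Proof.
move=> Hf Hg; have H : computable (fun z => prec 1 (fun _ r => r * f z) (g z)).
  apply: (@comp_prec (fun _ => 1) (fun z _ r => r * f z)) => //; first exact: comp_const.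
  exact: comp_mul (comp_p2' comp_p2) (comp_comp Hf comp_p1).
by apply: comp_ext H => n; elim: (g n) => /= [|k ->]; rewrite ?expn0 ?expnSr.
Qed.

Lemma dec_ext P Q : (forall n, P n <-> Q n) -> decidable_pred P -> decidable_pred Q.
Proof.
move=> E [f [Hf H]]; exists f; split=> // n.
by case: (H n) => -[H1 H2]; [left|right]; split=> //; rewrite -E.
Qed.

Lemma dec_and P Q : decidable_pred P -> decidable_pred Q -> decidable_pred (fun z => P z /\ Q z).
Proof.
move=> [f [Hf H]] [g [Hg H']]; exists (fun z => f z * g z); split; first exact: comp_mul.
by move=> n; case: (H n) => -[? ->]; case: (H' n) => -[? ->]; tauto.
Qed.

Lemma dec_not P : decidable_pred P -> decidable_pred (fun z => ~ P z).
Proof.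
move=> [f [Hf H]]; exists (fun z => 1 - f z); split; first exact: comp_sub (comp_const 1) Hf.
by move=> n; case: (H n) => -[? ->]; tauto.
Qed.

Lemma dec_or P Q : decidable_pred P -> decidable_pred Q -> decidable_pred (fun z => P z \/ Q z).
Proof.
move=> HP HQ; apply: dec_ext (dec_not (dec_and (dec_not HP) (dec_not HQ))) => n; tauto.
Qed.

Lemma dec_imp P Q : decidable_pred P -> decidable_pred Q -> decidable_pred (fun z => P z -> Q z).
Proof.
move=> HP HQ; apply: dec_ext (dec_not (dec_and HP (dec_not HQ))) => n; tauto.
Qed.

Lemma dec_iff P Q : decidable_pred P -> decidable_pred Q -> decidable_pred (fun z => P z <-> Q z).
Proof. by move=> HP HQ; apply: dec_and; apply: dec_imp. Qed.

Lemma dec_const (b : Prop) : decidable_pred (fun _ => b).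
Proof.
have [H|H] := classic b; first by exists (fun _ => 1); split; [exact: comp_const|left].
by exists (fun _ => 0); split; [exact: comp_const|right].
Qed.

Lemma dec_le f g : computable f -> computable g -> decidable_pred (fun z => f z <= g z).
Proof.
move=> Hf Hg; exists (fun z => 1 - (f z - g z)); split.
  exact: comp_sub (comp_const 1) (comp_sub Hf Hg).
by move=> n; case: (leqP (f n) (g n)) => H; [left|right]; split=> //; lia.
Qed.

Lemma dec_eq f g : computable f -> computable g -> decidable_pred (fun z => f z = g z).
Proof.
move=> Hf Hg; apply: dec_ext (dec_and (dec_le Hf Hg) (dec_le Hg Hf)) => n; lia.
Qed.

Lemma dec_all B (P : nat -> nat -> Prop) : computable B ->
  decidable_pred (fun z => P (p1 z) (p2 z)) -> decidable_pred (fun z => forall i, i < B z -> P z i).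
Proof.
move=> HB [g [Hg H]].
exists (fun z => prec 1 (fun i r => r * g (cpair z i)) (B z)); split.
  apply: (@comp_prec (fun _ => 1) (fun z i r => r * g (cpair z i))) => //; first exact: comp_const.
  apply: comp_mul (comp_p2' comp_p2) (comp_comp Hg _).
  exact: comp_pair comp_p1 (comp_p1' comp_p2).
move=> n; elim: (B n) => [|b IH] /=; first by left.
have := H (cpair n b); rewrite p1E p2E => -[[Hb ->]|[Hb ->]]; last first.
  by right; rewrite muln0; split=> // H'; apply: Hb; apply: H'.
case: IH => -[H1 ->]; [left|right]; split=> //.
  by move=> i; rewrite ltnS leq_eqVlt => /orP[/eqP -> //|]; apply: H1.
by move=> H2; apply: H1 => i Hi; apply: H2; apply: leqW.
Qed.

Lemma dec_ex B (P : nat -> nat -> Prop) : computable B ->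
  decidable_pred (fun z => P (p1 z) (p2 z)) ->
  decidable_pred (fun z => exists i, i < B z /\ P z i).
Proof.
move=> HB HP.
apply: dec_ext (dec_not (@dec_all B (fun z i => ~ P z i) HB (dec_not HP))) => n; split.
  by move=> H; apply: NNPP => H'; apply: H => i Hi Hp; apply: H'; exists i.
by case=> i [Hi Hp] H; apply: (H i).
Qed.

Lemma comp_graph f : decidable_pred (fun z => f (p1 z) = p2 z) -> computable f.
Proof.
(* [CMu] searches for a zero, so the graph is negated to make its characteristic function vanish
   exactly there. *)
move=> /dec_not[g [[c Hg] H]]; exists (CMu c) => n; constructor.
  have := Hg (cpair n (f n)); have := H (cpair n (f n)); rewrite p1E p2E.
  by case=> -[// _ ->].
move=> i Hi; have := Hg (cpair n i); have := H (cpair n i); rewrite p1E p2E.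
case=> -[H1 ->] H2; first by exists 1.
by exfalso; apply: H1; lia.
Qed.

Lemma dec_lt f g : computable f -> computable g -> decidable_pred (fun z => f z < g z).
Proof. by move=> Hf Hg; apply: dec_le => //; apply: comp_S. Qed.

Lemma comp_div f g : computable f -> computable g -> computable (fun z => f z %/ g z).
Proof.
move=> Hf Hg; apply: comp_graph.
have Hf1 := comp_comp Hf comp_p1; have Hg1 := comp_comp Hg comp_p1.
have H0 := dec_and (dec_eq Hg1 (comp_const 0)) (dec_eq comp_p2 (comp_const 0)).
have H1 := dec_and (dec_le (comp_mul comp_p2 Hg1) Hf1)
                   (dec_lt Hf1 (comp_mul (comp_S comp_p2) Hg1)).
apply: dec_ext (dec_or H0 H1) => z; set a := f _; set b := g _; set q := p2 z.
split=> [[[-> ->]|[h1 h2]]|<-]; first by rewrite divn0.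
  have b0 : 0 < b by case: (b) h1 h2; lia.
  by apply/eqP; rewrite eqn_leq -ltnS ltn_divLR // h2 leq_divRL.
case: (posnP b) => [->|b0]; first by left; rewrite divn0.
by right; split; [exact: leq_trunc_div|rewrite -ltn_divLR].
Qed.

Lemma comp_mod f g : computable f -> computable g -> computable (fun z => f z %% g z).
Proof.
move=> Hf Hg; apply: comp_ext (comp_sub Hf (comp_mul (comp_div Hf Hg) Hg)) => n.
by rewrite {1}(divn_eq (f n) (g n)) addKn.
Qed.

Lemma comp_iter (h : nat -> nat) f g : computable h -> computable f -> computable g ->
  computable (fun z => iter (f z) h (g z)).
Proof.
move=> Hh Hf Hg; have H : computable (fun z => prec (g z) (fun _ r => h r) (f z)).
  apply: (@comp_prec g (fun _ _ r => h r)) => //.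
  exact: comp_comp Hh (comp_p2' comp_p2).
by apply: comp_ext H => n; elim: (f n) => //= k ->.
Qed.

Lemma decidable_computably (Y : Type) (enc : Y -> nat) (P : Y -> Prop) (R : nat -> Prop) :
  decidable_pred R -> (forall x, P x <-> R (enc x)) -> computably_decidable enc P.
Proof.
move=> [f [[c Hc] H]] E; exists c => x; have := Hc (enc x).
by case: (H (enc x)) => -[H1 ->] H2; split=> //; rewrite E.
Qed.

(** * Certificates as bounded arithmetic *)

Definition digit (b y i : nat) : nat := (y %/ b ^ i) %% b.

Lemma digit_lt b y i : 0 < b -> digit b y i < b.
Proof. by move=> H; rewrite ltn_mod. Qed.

Lemma digit0 b i : digit b 0 i = 0.
Proof. by rewrite /digit div0n mod0n. Qed.

(** Turns the existence of a finite table into a bounded quantifier over numbers. *)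
Lemma digits_exist b n (g : nat -> nat) : 0 < b -> (forall i, i < n -> g i < b) ->
  exists y, y < b ^ n /\ forall i, i < n -> digit b y i = g i.
Proof.
move=> b0; elim: n => [|n IH] H; first by exists 0.
have [|y [H1 H2]] := IH; first by move=> i Hi; apply: H; apply: leqW.
have bn : 0 < b ^ n by rewrite expn_gt0 b0.
exists (g n * b ^ n + y); split; first by rewrite expnS; have := H n (ltnSn n); nia.
move=> i; rewrite ltnS leq_eqVlt => /orP[/eqP ->|Hi].
  by rewrite /digit divnMDl // divn_small // addn0 modn_small // H.
have bi : 0 < b ^ i by rewrite expn_gt0 b0.
have E : g n * b ^ n = (g n * b ^ (n - i.+1) * b) * b ^ i.
  by rewrite -{2}(subnK Hi) expnD expnS !mulnA.
by rewrite -(H2 i Hi) /digit E divnMDl // modnMDl.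
Qed.

Section Params.
Variables k m : nat.

(* x is the code of the instance; it bounds all its clocks, locations and constants.
   In a vector, entry 0 is the current time, entries 1..k are the last reset times of the
   controller clocks, and entry k+1+y is the last reset time of the clock y. *)
Definition nclk x := k + x.+1.
Definition cmax x := x + m.
(** One unit of time is cut into as many parts as points are rounded together: the [nclk x + 1]
    entries of a vector and one later time. The ranks of their fractional parts then fit below
    [grid x]. *)
Definition grid x := (nclk x).+2.
Definition box x := (nclk x).+2 * ((cmax x).+1 * grid x).
Definition nvec x := (box x).+1 ^ (nclk x).+1.
Definition get x v i := digit (box x).+1 v i.
Definition nstate x := 2 * x.+1 * nvec x.
Definition nmem x := (2 ^ nstate x) ^ nstate x.
Definition maxrank x := (nmem x * nstate x).+2.

Definition cmpN (c a b : nat) : Prop :=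
  (c = 0 /\ a < b) \/ (c = 1 /\ a <= b) \/ (c = 2 /\ a = b) \/ (c = 3 /\ b <= a) \/ (c = 4 /\ b < a).
(** Compares [(a - b) / grid x] with the integer coded by [e]; its sign decides the side to which it
    is moved, so that only natural numbers occur. *)
Definition cmpE x (c e a b : nat) : Prop :=
  (p1 e = 0 /\ cmpN c a (b + p2 e * grid x)) \/ (p1 e = 1 /\ cmpN c (a + p2 e * grid x) b).

(** One clause per tag of [enc_guard]; looking subguards up in the table [t] replaces recursion on
    guards, which bounded formulas cannot express directly. *)
Definition local_sat x w t h : Prop :=
  p1 h = 0 \/
  (p1 h = 1 /\ cmpE x (p1 (p2 (p2 h))) (p2 (p2 (p2 h))) (get x w 0) (get x w (k.+1 + p1 (p2 h)))) \/
  (p1 h = 2 /\ cmpE x (p1 (p2 (p2 (p2 h)))) (p2 (p2 (p2 (p2 h))))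
     (get x w (k.+1 + p1 (p2 (p2 h)))) (get x w (k.+1 + p1 (p2 h)))) \/
  (p1 h = 3 /\ ~ digit 2 t (p2 h) = 1) \/
  (p1 h = 4 /\ digit 2 t (p1 (p2 h)) = 1 /\ digit 2 t (p2 (p2 h)) = 1) \/
  (p1 h = 5 /\ (digit 2 t (p1 (p2 h)) = 1 \/ digit 2 t (p2 (p2 h)) = 1)).

(* The digits of t are the truth values of all (codes of) subguards of g. *)
Definition sat_code x g w : Prop :=
  exists t, t < 2 ^ g.+1 /\
    ((forall h, h < g.+1 -> (digit 2 t h = 1 <-> local_sat x w t h)) /\ digit 2 t g = 1).

Definition tail_code l := p2 l.-1.
Definition in_code l a : Prop :=
  exists i, i < l /\ (iter i tail_code l <> 0 /\ p1 (iter i tail_code l).-1 = a).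

Definition eqv_code n M D x u v : Prop :=
  forall i, i < n.+1 -> forall j, j < n.+1 -> forall z, z < M.+1 ->
    (get x u i < get x u j + z * D <-> get x v i < get x v j + z * D) /\
    (get x u i + z * D < get x u j <-> get x v i + z * D < get x v j).

Definition reset_code e Y i : Prop :=
  (i < k /\ digit 2 Y i = 1) \/ (k <= i /\ in_code (p1 (p2 (p2 (p2 e)))) (i - k)).

(** [v] is a representative of the region of [u] with room for the delay: [w] shares its reset times
    and has a current time that is not earlier. The guard is tested at [w], and [u'] is [w] after
    the resets. *)
Definition edge_code x e Y u w u' : Prop :=
  exists v, v < nvec x /\
    (eqv_code (nclk x) (cmax x) (grid x) x u v /\
    (forall i, i < nclk x -> get x w i.+1 = get x v i.+1) /\
    get x v 0 <= get x w 0 /\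
    sat_code x (p1 (p2 (p2 e))) w /\
    get x u' 0 = get x w 0 /\
    (forall i, i < nclk x -> (reset_code e Y i -> get x u' i.+1 = get x w 0) /\
      (~ reset_code e Y i -> get x u' i.+1 = get x w i.+1))).

Definition ta_code x := p2 (p2 x).
Definition init_code x := p1 (ta_code x).
Definition final_code x := p1 (p2 (ta_code x)).
Definition rules_code x := p2 (p2 (ta_code x)).

(* The flag tells whether a final location was left since the last letter.  Accepting
   visits are counted once per letter because a cycle of epsilon-rules through a final
   location may be iterated arbitrarily often without accepting anything. *)
Definition flag_code x f e f' : Prop := f' = 1 <-> f = 1 \/ in_code (final_code x) (p1 e).

Definition cert_init x (rk : nat -> nat -> nat -> nat -> nat) : Prop :=
  exists p, p < nmem x /\ forall loc, loc < x.+1 -> in_code (init_code x) loc -> 0 < rk p 0 loc 0.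

Definition cert_eps x (rk : nat -> nat -> nat -> nat -> nat) : Prop :=
  forall p, p < nmem x -> forall f, f < 2 -> forall f', f' < 2 ->
  forall e, e < x.+1 -> in_code (rules_code x) e -> p1 (p2 e) = 0 -> flag_code x f e f' ->
  forall u, u < nvec x -> forall w, w < nvec x -> forall u', u' < nvec x ->
  edge_code x e 0 u w u' -> 0 < rk p f (p1 e) u ->
  0 < rk p f' (p2 (p2 (p2 (p2 e)))) u' /\ rk p f' (p2 (p2 (p2 (p2 e)))) u' <= rk p f (p1 e) u.

(** The answer is chosen from the memory [p], the letter [a] and the region of the controller
    clocks, given by [c], before the automaton state and the rule are quantified: it must suit all
    runs. The flag restarts at 0 after the letter. *)
Definition cert_letter x (rk : nat -> nat -> nat -> nat -> nat) : Prop :=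
  forall p, p < nmem x -> forall a, a < p1 x -> forall c, c < nvec x ->
  exists b, b < p1 (p2 x) /\ exists Y, Y < 2 ^ k /\ exists p', p' < nmem x /\
  forall f, f < 2 -> forall f', f' < 2 ->
  forall e, e < x.+1 -> in_code (rules_code x) e -> p1 (p2 e) = (cpair a b).+1 -> flag_code x f e f' ->
  forall u, u < nvec x -> forall w, w < nvec x -> forall u', u' < nvec x ->
  edge_code x e Y u w u' -> eqv_code k m (grid x) x w c -> 0 < rk p f (p1 e) u ->
  0 < rk p' 0 (p2 (p2 (p2 (p2 e)))) u' /\
  rk p' 0 (p2 (p2 (p2 (p2 e)))) u' + f' <= rk p f (p1 e) u.

Definition certificate x rk := cert_init x rk /\ cert_eps x rk /\ cert_letter x rk.

Definition state_index x p f loc u := ((p * 2 + f) * x.+1 + loc) * nvec x + u.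
Definition table x y p f loc u := digit (maxrank x) y (state_index x p f loc u).
Definition has_certificate x :=
  exists y, y < maxrank x ^ (nmem x * nstate x) /\ certificate x (table x y).

(** * Decidability of the existence of a certificate *)

Lemma comp_digit f g h : computable f -> computable g -> computable h ->
  computable (fun z => digit (f z) (g z) (h z)).
Proof. by move=> Hf Hg Hh; apply: comp_mod (comp_div Hg (comp_exp Hf Hh)) Hf. Qed.

(** Redefined as soon as a new function is shown computable, so that later goals treat it as atomic
    instead of unfolding it. *)
Ltac comp_hook := fail.
Ltac comp1 :=
  match goal with
  | |- computable (fun z => z) => exact comp_id
  | |- computable (fun _ => ?c) => exact (comp_const c)
  | |- computable p1 => exact comp_p1
  | |- computable p2 => exact comp_p2
  | H : computable ?f |- computable ?f => exact H
  | |- computable (fun z => p1 (@?f z)) => apply (@comp_p1' f)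
  | |- computable (fun z => p2 (@?f z)) => apply (@comp_p2' f)
  | |- computable (fun z => cpair (@?f z) (@?g z)) => apply (@comp_pair f g)
  | |- computable (fun z => S (@?f z)) => apply (@comp_S f)
  | |- computable (fun z => predn (@?f z)) => apply (@comp_pred f)
  | |- computable (fun z => addn (@?f z) (@?g z)) => apply (@comp_add f g)
  | |- computable (fun z => subn (@?f z) (@?g z)) => apply (@comp_sub f g)
  | |- computable (fun z => muln (@?f z) (@?g z)) => apply (@comp_mul f g)
  | |- computable (fun z => expn (@?f z) (@?g z)) => apply (@comp_exp f g)
  | |- computable (fun z => digit (@?f z) (@?g z) (@?h z)) => apply (@comp_digit f g h)
  | _ => comp_hook
  | H : computable ?h |- computable (fun z => ?h (@?f z)) => apply (@comp_comp h f H)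
  end.
Ltac dec_hook := fail.
Ltac dec1 :=
  match goal with
  | |- computable _ => comp1
  | |- decidable_pred (fun _ => ?c) => exact (dec_const c)
  | _ => dec_hook
  | |- decidable_pred (fun z => forall i : nat, is_true (leq (S i) (@?B z)) -> @?P z i) => apply (@dec_all B P)
  | |- decidable_pred (fun z => @ex nat (fun i => is_true (leq (S i) (@?B z)) /\ @?P z i)) => apply (@dec_ex B P)
  | |- decidable_pred (fun z => (@?P z) /\ (@?Q z)) => apply (@dec_and P Q)
  | |- decidable_pred (fun z => (@?P z) \/ (@?Q z)) => apply (@dec_or P Q)
  | |- decidable_pred (fun z => (@?P z) <-> (@?Q z)) => apply (@dec_iff P Q)
  | |- decidable_pred (fun z => ~ (@?P z)) => apply (@dec_not P)
  | |- decidable_pred (fun z => (@?P z) -> (@?Q z)) => apply (@dec_imp P Q)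
  | |- decidable_pred (fun z => is_true (leq (@?f z) (@?g z))) => apply (@dec_le f g)
  | |- decidable_pred (fun z => @eq nat (@?f z) (@?g z)) => apply (@dec_eq f g)
  end.
Ltac dec_solve := repeat (cbv beta; dec1).

Lemma comp_nclk f : computable f -> computable (fun z => nclk (f z)).
Proof. rewrite /nclk => *; dec_solve. Qed.
Lemma comp_cmax f : computable f -> computable (fun z => cmax (f z)).
Proof. rewrite /cmax => *; dec_solve. Qed.
Lemma comp_grid f : computable f -> computable (fun z => grid (f z)).
Proof. rewrite /grid /nclk => *; dec_solve. Qed.
Lemma comp_nvec f : computable f -> computable (fun z => nvec (f z)).
Proof. rewrite /nvec /box /grid /cmax /nclk => *; dec_solve. Qed.
Lemma comp_get f g h : computable f -> computable g -> computable h ->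
  computable (fun z => get (f z) (g z) (h z)).
Proof. rewrite /get /box /grid /cmax /nclk => *; dec_solve. Qed.
Ltac comp_hook ::= apply comp_nvec.
Lemma comp_nstate f : computable f -> computable (fun z => nstate (f z)).
Proof. rewrite /nstate => *; dec_solve. Qed.
Ltac comp_hook ::= apply comp_nstate.
Lemma comp_nmem f : computable f -> computable (fun z => nmem (f z)).
Proof. rewrite /nmem => *; dec_solve. Qed.
Ltac comp_hook ::= first [apply comp_nvec | apply comp_nstate | apply comp_nmem].
Lemma comp_maxrank f : computable f -> computable (fun z => maxrank (f z)).
Proof. rewrite /maxrank => *; dec_solve. Qed.
Ltac comp_hook ::= first [apply comp_nvec | apply comp_maxrank].
Lemma comp_table f y p b l u : computable f -> computable y -> computable p -> computable b ->
  computable l -> computable u -> computable (fun z => table (f z) (y z) (p z) (b z) (l z) (u z)).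
Proof. rewrite /table /state_index => *; dec_solve. Qed.
Lemma comp_nth_tail f g : computable f -> computable g ->
  computable (fun z => iter (f z) tail_code (g z)).
Proof. by move=> Hf Hg; apply: comp_iter => //; rewrite /tail_code; dec_solve. Qed.
Ltac comp_hook ::= first [apply comp_nclk | apply comp_cmax | apply comp_grid | apply comp_nvec
  | apply comp_get | apply comp_nstate | apply comp_nmem | apply comp_maxrank | apply comp_table
  | apply comp_nth_tail].

Lemma dec_in_code f g : computable f -> computable g -> decidable_pred (fun z => in_code (f z) (g z)).
Proof. rewrite /in_code => *; dec_solve. Qed.
Lemma dec_cmpE x f g h l : computable x -> computable f -> computable g -> computable h ->
  computable l -> decidable_pred (fun z => cmpE (x z) (f z) (g z) (h z) (l z)).
Proof. rewrite /cmpE /cmpN => *; dec_solve. Qed.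
Ltac dec_hook ::= first [apply dec_in_code | apply dec_cmpE].
Lemma dec_sat_code x g w : computable x -> computable g -> computable w ->
  decidable_pred (fun z => sat_code (x z) (g z) (w z)).
Proof. rewrite /sat_code /local_sat => *; dec_solve. Qed.
Lemma dec_eqv_code n M D x u v : computable n -> computable M -> computable D -> computable x ->
  computable u -> computable v ->
  decidable_pred (fun z => eqv_code (n z) (M z) (D z) (x z) (u z) (v z)).
Proof. rewrite /eqv_code => *; dec_solve. Qed.
Lemma dec_reset_code f g h : computable f -> computable g -> computable h ->
  decidable_pred (fun z => reset_code (f z) (g z) (h z)).
Proof. rewrite /reset_code => *; dec_solve. Qed.
Ltac dec_hook ::= first [apply dec_in_code | apply dec_cmpE | apply dec_sat_code
  | apply dec_eqv_code | apply dec_reset_code].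
Lemma dec_edge_code x e y u v w : computable x -> computable e -> computable y -> computable u ->
  computable v -> computable w ->
  decidable_pred (fun z => edge_code (x z) (e z) (y z) (u z) (v z) (w z)).
Proof. rewrite /edge_code => *; dec_solve. Qed.
Lemma dec_flag_code x e f g : computable x -> computable e -> computable f -> computable g ->
  decidable_pred (fun z => flag_code (x z) (f z) (e z) (g z)).
Proof. rewrite /flag_code /final_code /ta_code => *; dec_solve. Qed.
Ltac dec_hook ::= first [apply dec_in_code | apply dec_eqv_code | apply dec_edge_code
  | apply dec_flag_code].

Lemma dec_certificate : decidable_pred has_certificate.
Proof.
rewrite /has_certificate /certificate /cert_init /cert_eps /cert_letter /init_code /rules_code /ta_code.
dec_solve.
Qed.
End Params.

(** * Reading the code of an instance *)

Lemma enc_seq_size (T : Type) (f : T -> nat) s : size s <= enc_seq f s.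
Proof. by elim: s => //= a s IH; rewrite ltnS; apply: leq_trans IH (cpair_ger _ _). Qed.

Lemma in_codeP (T : Type) (f : T -> nat) s a :
  in_code (enc_seq f s) a <-> exists y, List.In y s /\ f y = a.
Proof.
have tl y s' : tail_code (enc_seq f (y :: s')) = enc_seq f s' by rewrite /tail_code /= p2E.
split.
  case=> i [_]; elim: i s => [|i IH] [|y s] //=.
  - by case.
  - by case=> _; rewrite p1E => <-; exists y; split=> //; left.
  - rewrite -iterS iterSr; have -> : tail_code 0 = 0 by [].
    by case: (iter i tail_code 0) (IH [::]) => [|n] // H /H [? []].
  - rewrite -iterS iterSr -/(enc_seq f (y :: s)) tl => /IH[y' [H1 H2]].
    by exists y'; split=> //; right.
case=> y [Hin <-].
have [i [Hi [s' E]]] : exists i, i < size s /\ exists s', iter i tail_code (enc_seq f s) = enc_seq f (y :: s').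
  elim: s Hin => //= y' s IH [<-|/IH[i [Hi [s' E]]]]; first by exists 0; split=> //; exists s.
  by exists i.+1; split=> //; exists s'; rewrite iterSr -/(enc_seq f (y' :: s)) tl.
exists i; rewrite E /= p1E; split=> //; apply: leq_trans Hi (enc_seq_size _ _).
Qed.

Lemma List_In_mem (T : eqType) (a : T) s : List.In a s <-> a \in s.
Proof.
elim: s => //= b s IH; rewrite in_cons; split.
  by case=> [->|/IH ->]; rewrite ?eqxx ?orbT.
by case/orP => [/eqP ->|/IH]; [left|right].
Qed.

Lemma in_code_id s a : in_code (enc_seq id s) a <-> a \in s.
Proof.
rewrite in_codeP; split=> [[y [H <-]]|H]; first exact/List_In_mem.
by exists a; split=> //; apply/List_In_mem.
Qed.

Lemma enc_seq_in (T : Type) (f : T -> nat) s y : List.In y s -> f y <= enc_seq f s.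
Proof.
elim: s => //= a s IH [->|/IH H]; first by apply: leqW; apply: cpair_gel.
by apply: leqW; apply: leq_trans H (cpair_ger _ _).
Qed.

Lemma enc_Z_abs z x : enc_Z z <= x -> (Z.abs z <= Z.of_nat x)%Z.
Proof.
rewrite /enc_Z; case: (Z.leb_spec 0 z) => H.
  have := cpair_ger 0 (Z.to_nat z); lia.
have := cpair_ger 1 (Z.to_nat (- z)); lia.
Qed.

Lemma enc_guard_over g x : enc_guard g <= x -> guard_over x.+1 x g.
Proof.
have H := cpair_le; elim: g => //= [y c z|y y' c z|g1 IH1|g1 IH1 g2 IH2|g1 IH1 g2 IH2].
- by case/H=> _ /H[h1 /H[_ /enc_Z_abs h2]].
- by case/H=> _ /H[h1 /H[h3 /H[_ /enc_Z_abs h2]]].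
- by case/H=> _ /IH1.
- by case/H=> _ /H[/IH1 h1 /IH2 h2].
- by case/H=> _ /H[/IH1 h1 /IH2 h2].
Qed.

(** * Grid vectors as real points *)

Section Grid.
Variables k m : nat.
Notation grid := (grid k).
Notation get := (get k m).

Definition pt x w i : R := (INR (get x w i) / INR (grid x))%R.

Definition sat_points (p : nat -> R) g := sat (fun x => (p 0%N - p (k.+1 + x)%N)%R) g.

(** Strict upper bounds suffice: exchanging [i] and [j] and negating [z] gives the lower bounds,
    hence all five comparisons. *)
Definition eqv n M (p q : nat -> R) := forall i j, i <= n -> j <= n ->
  forall z, (Z.abs z <= Z.of_nat M)%Z -> (p i - p j < IZR z <-> q i - q j < IZR z)%R.

Lemma grid_pos x : (0 < INR (grid x))%R.
Proof. by apply: lt_0_INR; apply/ltP. Qed.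

Lemma grid_diff x a b z :
  exists d : Z, (d = Z.of_nat a - (Z.of_nat b + z * Z.of_nat (grid x)))%Z /\
  (INR a / INR (grid x) - INR b / INR (grid x) - IZR z = IZR d / INR (grid x))%R.
Proof.
eexists; split; first reflexivity.
have := grid_pos x; rewrite minus_IZR plus_IZR mult_IZR -!INR_IZR_INZ => H.
field; lra.
Qed.

Lemma grid_sign x d : (IZR d / INR (grid x) < 0 <-> (d < 0)%Z)%R /\
  (0 < IZR d / INR (grid x) <-> (0 < d)%Z)%R.
Proof.
have HD := grid_pos x; have Hi := Rinv_0_lt_compat _ HD; rewrite /Rdiv.
split; split=> H.
- case: (Z_lt_le_dec d 0) => // h; have := IZR_le _ _ h => h'.
  by have := Rmult_le_pos _ _ h' (Rlt_le _ _ Hi); lra.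
- by have := IZR_lt _ _ H => h; have := Rmult_lt_compat_r _ _ _ Hi h; lra.
- case: (Z_lt_le_dec 0 d) => // h; have := IZR_le _ _ h => h'.
  by have := Rmult_le_compat_r _ _ _ (Rlt_le _ _ Hi) h'; lra.
- by have := IZR_lt _ _ H => h; have := Rmult_lt_compat_r _ _ _ Hi h; lra.
Qed.

Definition cmpZ (c : cmp) (u v : Z) : Prop :=
  match c with
  | CLt => (u < v)%Z | CLe => (u <= v)%Z | CEq => u = v | CGe => (u >= v)%Z | CGt => (u > v)%Z
  end.

Lemma grid_cmp x c a b z :
  cmpR c (INR a / INR (grid x) - INR b / INR (grid x)) (IZR z) <->
  cmpZ c (Z.of_nat a) (Z.of_nat b + z * Z.of_nat (grid x)).
Proof.
have [d [Ed E]] := grid_diff x a b z; have [[S1 S1'] [S2 S2']] := grid_sign x d.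
have T : (d < 0 \/ d = 0 \/ 0 < d)%Z by lia.
have Z0 : (d = 0)%Z -> (IZR d / INR (grid x) = 0)%R by move=> ->; rewrite /Rdiv Rmult_0_l.
case: T => [h|[h|h]].
- have := S1' h; case: c => h'; rewrite /cmpR /cmpZ; split=> H; first [lia|lra|exfalso; lra].
- have := Z0 h; case: c => h'; rewrite /cmpR /cmpZ; split=> H; first [lia|lra|exfalso; lra].
- have := S2' h; case: c => h'; rewrite /cmpR /cmpZ; split=> H; first [lia|lra|exfalso; lra].
Qed.

Lemma cmpE_P x c z a b : cmpE k x (enc_cmp c) (enc_Z z) a b <->
  cmpR c (INR a / INR (grid x) - INR b / INR (grid x)) (IZR z).
Proof.
rewrite grid_cmp /cmpE /enc_Z /cmpN; case: (Z.leb_spec 0 z) => Hz; rewrite p1E p2E.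
  have <- : Z.of_nat (Z.to_nat z * grid x) = (z * Z.of_nat (grid x))%Z by nia.
  by move: (_ * grid x) => G; case: c; rewrite /cmpZ /enc_cmp; lia.
have E : (z * Z.of_nat (grid x) = - Z.of_nat (Z.to_nat (- z) * grid x))%Z by nia.
by rewrite E; move: (_ * grid x) => G; case: c; rewrite /cmpZ /enc_cmp; lia.
Qed.

Lemma eqv_codeP n M x u v :
  eqv_code k m n M (grid x) x u v <-> eqv n M (pt x u) (pt x v).
Proof.
have L a b z : ((INR a / INR (grid x) - INR b / INR (grid x) < IZR z)%R <->
    (Z.of_nat a < Z.of_nat b + z * Z.of_nat (grid x))%Z) by exact: (grid_cmp x CLt).
split=> [H i j Hi Hj z Hz|H i Hi j Hj z Hz].
  rewrite /pt !L; have [H1 H2] := H i Hi j Hj (Z.abs_nat z) ltac:(lia).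
  by case: (Z_lt_le_dec z 0) => h; nia.
have H1 := H i j Hi Hj (Z.of_nat z) ltac:(lia); have H2 := H i j Hi Hj (- Z.of_nat z)%Z ltac:(lia).
by move: H1 H2; rewrite /pt !L; split; nia.
Qed.

(** Subguards have smaller codes than the guard, so the digit at [n] can be fixed from the digits
    below it. *)
Lemma sat_code_exists x w n : exists t, t < 2 ^ n /\
  forall h, h < n -> (digit 2 t h = 1 <-> local_sat k m x w t h).
Proof.
elim: n => [|n [t [Ht H]]]; first by exists 0.
pose g i := if i < n then digit 2 t i else (if excluded_middle_informative (local_sat k m x w t n) then 1 else 0).
have [|t' [Ht' H']] := @digits_exist 2 n.+1 g isT.
  by move=> i _; rewrite /g; case: ifP => _; [rewrite digit_lt|case: excluded_middle_informative].
have E i : i < n -> digit 2 t' i = digit 2 t i by move=> Hi; rewrite H' ?leqW // /g Hi.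
have loc h : h <= n -> (local_sat k m x w t h <-> local_sat k m x w t' h).
  move=> hn.
  have q2 : 0 < p1 h -> p2 h < h by move=> h0; rewrite -{2}(cpairE h); apply: cpair_gtr.
  have q1 : p1 (p2 h) <= p2 h by rewrite -{2}(cpairE (p2 h)); apply: cpair_gel.
  have q3 : p2 (p2 h) <= p2 h by rewrite -{2}(cpairE (p2 h)); apply: cpair_ger.
  rewrite /local_sat; case: (posnP (p1 h)) => [->|h0]; first by intuition.
  by rewrite !E //; lia.
exists t'; split=> // h; rewrite ltnS leq_eqVlt => /orP[/eqP ->|hn].
  rewrite H' // /g ltnn -loc //; by case: excluded_middle_informative.
by rewrite -loc ?E ?H // ltnW.
Qed.

Lemma sat_codeP x g w : sat_code k m x (enc_guard g) w <-> sat_points (pt x w) g.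
Proof.
have main t : forall g n, enc_guard g < n ->
    (forall h, h < n -> (digit 2 t h = 1 <-> local_sat k m x w t h)) ->
    (digit 2 t (enc_guard g) = 1 <-> sat_points (pt x w) g).
  have X a b n : cpair a b < n -> b < n by apply: leq_ltn_trans; apply: cpair_ger.
  have X' a b n : cpair a b < n -> a < n by apply: leq_ltn_trans; apply: cpair_gel.
  move=> g0 n; elim: g0 => [|y c z|y y' c z|g1 IH1|g1 IH1 g2 IH2|g1 IH1 g2 IH2] /= Hn H; rewrite H // /local_sat !(p1E, p2E).
  - by split=> // _; left.
  - rewrite cmpE_P /sat_points /= /pt; intuition; discriminate.
  - rewrite cmpE_P /sat_points /= /pt.
    have -> : forall a b c : R, (a - b - (a - c) = c - b)%R by move=> *; ring.
    intuition; discriminate.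
  - have {}IH1 := IH1 (X _ _ _ Hn) H; rewrite /sat_points /= -/(sat_points _ _) -IH1.
    intuition; discriminate.
  - have {}IH1 := IH1 (X' _ _ _ (X _ _ _ Hn)) H; have {}IH2 := IH2 (X _ _ _ (X _ _ _ Hn)) H.
    rewrite /sat_points /= -!/(sat_points _ _) -IH1 -IH2; intuition; discriminate.
  - have {}IH1 := IH1 (X' _ _ _ (X _ _ _ Hn)) H; have {}IH2 := IH2 (X _ _ _ (X _ _ _ Hn)) H.
    rewrite /sat_points /= -!/(sat_points _ _) -IH1 -IH2; intuition; discriminate.
split=> [[t [Ht [H1 H2]]]|H]; first by apply/(main t g _ (ltnSn _) H1).
have [t [Ht Hl]] := sat_code_exists x w (enc_guard g).+1.
by exists t; split=> //; split=> //; apply/(main t g _ (ltnSn _) Hl).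
Qed.
End Grid.

(** * Clock regions as integer vectors *)

Lemma exists_max (g : nat -> R) (P : nat -> Prop) N : (exists i, i < N /\ P i) ->
  exists i, [/\ i < N, P i & forall j, j < N -> P j -> (g j <= g i)%R].
Proof.
elim: N => [|N IH] [i [Hi HP]] //.
have [[i' [Hi' HP']]|Hno] := classic (exists i, i < N /\ P i); last first.
  have Ei j : j < N.+1 -> P j -> j = N.
    move=> Hj Pj; apply/eqP; rewrite eqn_leq -ltnS Hj leqNgt /=; apply/negP => h.
    by apply: Hno; exists j.
  exists i; split=> // j Hj Pj; rewrite (Ei j) // (Ei i) //; lra.
have [a [Ha Pa Hm]] : exists i, [/\ i < N, P i & forall j, j < N -> P j -> (g j <= g i)%R].
  by apply: IH; exists i'.
have [[PN h]|h] := classic (P N /\ (g a <= g N)%R).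
  exists N; split=> // j; rewrite ltnS leq_eqVlt => /orP[/eqP -> _|Hj Pj]; first lra.
  by have := Hm j Hj Pj; lra.
exists a; split=> //; first exact: leqW.
move=> j; rewrite ltnS leq_eqVlt => /orP[/eqP -> PN|Hj Pj]; last exact: Hm.
by case: (Rle_lt_dec (g a) (g N)) => h'; [case: h|lra].
Qed.

Lemma exists_min (g : nat -> R) (P : nat -> Prop) N : (exists i, i < N /\ P i) ->
  exists i, [/\ i < N, P i & forall j, j < N -> P j -> (g i <= g j)%R].
Proof.
case/(exists_max (fun i => - g i)%R) => i [H1 H2 H3]; exists i; split=> // j Hj Pj.
by have := H3 j Hj Pj; lra.
Qed.

(** One step of back-and-forth: a point is added between, beyond or on finitely many points, since
    the real line is dense and has no endpoints. *)
Lemma match_point (g g' : nat -> R) N t :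
  (forall i j, i < N -> j < N -> (g i < g j <-> g' i < g' j)%R) ->
  exists t', forall i, i < N -> (g i < t <-> g' i < t')%R /\ (t < g i <-> t' < g' i)%R.
Proof.
move=> H; have [[i [Hi Ei]]|Hne] := classic (exists i, i < N /\ g i = t).
  by exists (g' i) => j Hj; rewrite -Ei; split; apply: H.
have Hsep i : i < N -> (g i < t \/ t < g i)%R.
  by move=> Hi; case: (Rtotal_order (g i) t) => [|[E|]]; [left|case: Hne; exists i|right].
suff [t' Ht'] : exists t', forall i, i < N ->
    ((g i < t)%R -> (g' i < t')%R) /\ ((t < g i)%R -> (t' < g' i)%R).
  exists t' => i Hi; have [H1 H2] := Ht' i Hi.
  by case: (Hsep i Hi) => h; [have h' := H1 h|have h' := H2 h]; split; split=> ?; lra.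
have [HL|HL] := classic (exists i, i < N /\ (g i < t)%R);
  have [HR|HR] := classic (exists i, i < N /\ (t < g i)%R).
- have [a [Ha Pa Ma]] := exists_max g' HL; have [b [Hb Pb Mb]] := exists_min g' HR.
  have ab : (g' a < g' b)%R by apply/(H a b Ha Hb); lra.
  exists ((g' a + g' b) / 2)%R => i Hi; split=> h.
    by have := Ma i Hi h; lra.
  by have := Mb i Hi h; lra.
- have [a [Ha Pa Ma]] := exists_max g' HL; exists (g' a + 1)%R => i Hi; split=> h.
    by have := Ma i Hi h; lra.
  by case: HR; exists i.
- have [b [Hb Pb Mb]] := exists_min g' HR; exists (g' b - 1)%R => i Hi; split=> h.
    by case: HL; exists i.
  by have := Mb i Hi h; lra.
- by exists 0%R => i Hi; split=> h; [case: HL|case: HR]; exists i.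
Qed.

Definition set_now (p : nat -> R) (t : R) (i : nat) : R := if i is 0 then t else p i.

(* A later time t has only to be placed among the points p i + z with 0 <= z <= M, whose
   relative order is determined by the region. *)
Lemma elapse_match n M p q t : eqv n M p q -> (forall i, i <= n -> (p i <= p 0%N)%R) ->
  (p 0%N <= t)%R -> exists t', (q 0%N <= t')%R /\ eqv n M (set_now p t) (set_now q t').
Proof.
move=> E Hp Ht.
(* The index [l = i * (M + 1) + z] enumerates the points [p i + z]. *)
pose g (p : nat -> R) l := (p (l %/ M.+1) + INR (l %% M.+1))%R.
have Hm l : l %% M.+1 <= M by rewrite -ltnS ltn_mod.
have Hd l : l < n.+1 * M.+1 -> l %/ M.+1 <= n by move=> h; rewrite -ltnS ltn_divLR.
have [|t' Ht'] := @match_point (g p) (g q) (n.+1 * M.+1) t.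
  move=> i j Hi Hj; rewrite /g.
  have := E _ _ (Hd _ Hi) (Hd _ Hj) (Z.of_nat (j %% M.+1) - Z.of_nat (i %% M.+1))%Z.
  have := Hm i; have := Hm j; move: (i %% _) (j %% _) => a b h1 h2 /(_ ltac:(lia)).
  by rewrite minus_IZR -!INR_IZR_INZ => -[h3 h4]; split=> h; [have := h3|have := h4]; lra.
have K i z : i <= n -> z <= M ->
    (p i + INR z < t <-> q i + INR z < t')%R /\ (t < p i + INR z <-> t' < q i + INR z)%R.
  move=> Hi Hz; have := Ht' (i * M.+1 + z) ltac:(nia).
  by rewrite /g divnMDl // modnMDl divn_small // addn0 modn_small.
have Hq i : i <= n -> (q i <= q 0%N)%R.
  by move=> Hi; have := E 0 i isT Hi 0%Z ltac:(lia); have := Hp i Hi; lra.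
have Hq0 : (q 0%N <= t')%R by have := K 0 0 isT isT; rewrite /=; lra.
exists t'; split=> // i j Hi Hj z Hz.
(* Comparisons with the new time that are not covered by these points have the same outcome on both
   sides, because no point lies after the new time. *)
have [Ez|Ez] : z = Z.of_nat (Z.abs_nat z) \/ z = (- Z.of_nat (Z.abs_nat z))%Z by lia.
  have Hz' : Z.abs_nat z <= M by lia.
  case: i Hi => [|i] Hi; case: j Hj => [|j] Hj /=; try exact: (E _ _ Hi Hj); try lra.
    have [_ h] := K j.+1 _ Hj Hz'; rewrite Ez -INR_IZR_INZ; lra.
  have h1 := Hp i.+1 Hi; have h2 := Hq i.+1 Hi.
  case: (posnP (Z.abs_nat z)) => h0.
    have [h _] := K i.+1 0 Hi isT; rewrite Ez h0 /=; move: h; rewrite /=; lra.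
  have : (0 < IZR z)%R by apply: IZR_lt; lia.
  by split; lra.
have Hz' : Z.abs_nat z <= M by lia.
case: i Hi => [|i] Hi; case: j Hj => [|j] Hj /=; try exact: (E _ _ Hi Hj); try lra.
  have h1 := Hp j.+1 Hj; have h2 := Hq j.+1 Hj.
  have : (IZR z <= 0)%R by apply: IZR_le; lia.
  by split; lra.
have [h _] := K i.+1 _ Hi Hz'; rewrite Ez opp_IZR -INR_IZR_INZ; lra.
Qed.

(** * Rounding real points to a bounded grid *)

Section Round.
Variables (N M : nat).
Notation G := (M.+1 * N).

Definition eqvZ (p : nat -> R) (u : nat -> Z) := forall i j, i < N -> j < N ->
  forall z, (Z.abs z <= Z.of_nat M)%Z -> ((p i - p j < IZR z)%R <-> (u i < u j + z * Z.of_nat N)%Z).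

(* Integer parts are kept and fractional parts are replaced by their ranks. *)
Lemma round_Z (p : nat -> R) : exists u : nat -> Z, eqvZ p u.
Proof.
pose fl i := Int_part (p i); pose fr i := frac_part (p i).
have Hfl i : p i = (IZR (fl i) + fr i)%R by rewrite /fl /fr /frac_part; ring.
have Hfr i : (0 <= fr i < 1)%R by have [] := base_fp (p i); rewrite /fr; lra.
pose ltb i j := if Rlt_dec (fr i) (fr j) then true else false.
have ltP i j : reflect (fr i < fr j)%R (ltb i j) by rewrite /ltb; case: Rlt_dec => h; constructor.
pose rk i := #|[set j : 'I_N | ltb j i]|.
have rk_lt i : i < N -> rk i < N.
  move=> Hi; rewrite -[X in _ < X](card_ord N) -cardsT; apply: proper_card; apply/properP; split.
    by apply/subsetP.
  by exists (Ordinal Hi); rewrite !inE //=; apply/negP => /ltP; lra.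
have rk_mono i j : i < N -> (fr i < fr j)%R -> rk i < rk j.
  move=> Hi h; apply: proper_card; apply/properP; split.
    by apply/subsetP => l; rewrite !inE => /ltP h'; apply/ltP; lra.
  by exists (Ordinal Hi); rewrite !inE /=; [apply/ltP|apply/negP => /ltP; lra].
have rk_le i j : (fr i <= fr j)%R -> rk i <= rk j.
  move=> h; apply: subset_leq_card.
  by apply/subsetP => l; rewrite !inE => /ltP h'; apply/ltP; lra.
exists (fun i => fl i * Z.of_nat N + Z.of_nat (rk i))%Z => i j Hi Hj z _.
rewrite (Hfl i) (Hfl j); have := Hfr i; have := Hfr j; have := rk_lt i Hi; have := rk_lt j Hj.
move=> h1 h2 h3 h4.
have [h|[h|h]] : (fl i - fl j < z \/ fl i - fl j = z \/ z < fl i - fl j)%Z by lia.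
- have : (IZR (fl i) - IZR (fl j) + 1 <= IZR z)%R by rewrite -minus_IZR -plus_IZR; apply: IZR_le; lia.
  by move=> h5; split=> _; [nia|lra].
- have : (IZR (fl i) - IZR (fl j) = IZR z)%R by rewrite -minus_IZR h.
  move=> h5; split=> h6.
    have := rk_mono i j Hi ltac:(lra); nia.
  case: (Rlt_le_dec (fr i) (fr j)) => h7; first lra.
  by have := rk_le _ _ h7; nia.
- have : (IZR z + 1 <= IZR (fl i) - IZR (fl j))%R by rewrite -minus_IZR -plus_IZR; apply: IZR_le; lia.
  by move=> h5; split=> h6; [lra|nia].
Qed.

Lemma round_nat (p : nat -> R) : exists u : nat -> nat, eqvZ p (fun i => Z.of_nat (u i)).
Proof.
have [u Hu] := round_Z p.
have [C HC] : exists C, forall i, i < N -> (0 <= u i + C)%Z.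
  elim: {1}N => [|n [C HC]]; first by exists 0%Z.
  exists (Z.abs C + Z.abs (u n))%Z => i; rewrite ltnS leq_eqVlt => /orP[/eqP ->|/HC]; lia.
exists (fun i => Z.to_nat (u i + C)) => i j Hi Hj z Hz; rewrite (Hu i j) // !Z2Nat.id; first lia.
  exact: HC.
exact: HC.
Qed.

(** Pigeonhole: if each of the [N] intervals of length [G] contained one of the [N] values, every
    value would lie in one of them, contradicting that [u i0] lies beyond them all. *)
Lemma interval_gap (u : nat -> nat) i0 : 0 < N -> i0 < N -> N * G < u i0 ->
  exists h, h < N /\ forall i, i < N -> u i <= h * G \/ h.+1 * G < u i.
Proof.
move=> N0 Hi0 Hu; apply: NNPP => Hno.
pose F (h : 'I_N) : 'I_N := odflt (Ordinal Hi0) [pick i : 'I_N | (h * G < u i) && (u i <= h.+1 * G)].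
have HF (h : 'I_N) : (h * G < u (F h)) && (u (F h) <= h.+1 * G).
  rewrite /F; case: pickP => //= H; exfalso; apply: Hno; exists h; split=> // i Hi.
  by have := H (Ordinal Hi); rewrite /=; lia.
have G0 : 0 < G by lia.
have injF : injective F.
  move=> h h' E; have := HF h; have := HF h'; rewrite E => H1 H2; apply/val_inj => /=.
  by case: (ltngtP h h') => // lt; nia.
have := injF_onto injF (Ordinal Hi0) => /codomP[h Eh].
have := HF h; rewrite -Eh /=; have := ltn_ord h; nia.
Qed.

(* If some value leaves the box, there is a gap longer than all constants, and the values
   above it can be lowered by one unit. *)
Lemma round_box (p : nat -> R) : 0 < N -> exists u : nat -> nat,
  eqvZ p (fun i => Z.of_nat (u i)) /\ forall i, i < N -> u i <= N * G.
Proof.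
move=> N0; have [u Hu] := round_nat p.
(* Each lowering makes the sum of the coordinates smaller. *)
have [s] := ubnP (\sum_(i < N) u i); elim: s u Hu => // s IH u Hu Hs.
have [H|H] := classic (forall i, i < N -> u i <= N * G); first by exists u.
have [i0 [Hi0 Hbig]] : exists i0, i0 < N /\ N * G < u i0.
  apply: NNPP => Hno; apply: H => i Hi; rewrite leqNgt; apply/negP => h; apply: Hno; by exists i.
have [h [HhN Hh]] := interval_gap N0 Hi0 Hbig.
have Hi0' : h.+1 * G < u i0 by case: (Hh i0 Hi0) => //; nia.
(* Values on the two sides of the gap differ by more than [(M + 1) * N], and still by more than
   [M * N] afterwards, so no comparison with a constant of absolute value at most [M] changes. *)
pose u' i := if h.+1 * G < u i then u i - N else u i.
apply: (IH u').
  move=> i j Hi Hj z Hz; rewrite Hu //.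
  have : (- Z.of_nat (M * N) <= z * Z.of_nat N <= Z.of_nat (M * N))%Z by nia.
  have : h.+1 * G = h * G + M * N + N by lia.
  move: (Hh i Hi) (Hh j Hj); rewrite /u' {Hu Hh Hi0' Hbig Hs}.
  move: (h.+1 * G) (h * G) (M * N) (z * _)%Z => a b c d.
  by case: ifP; case: ifP; lia.
have N1 : N <= u i0 by nia.
have E0 : u' i0 = u i0 - N by rewrite /u' Hi0'.
rewrite (bigD1 (Ordinal Hi0)) //= E0.
move: Hs; rewrite (bigD1 (Ordinal Hi0)) //=.
have : \sum_(i < N | i != Ordinal Hi0) u' i <= \sum_(i < N | i != Ordinal Hi0) u i.
  by apply: leq_sum => i _; rewrite /u'; case: ifP; lia.
set a := \sum_(_ < _ | _) u' _; set b := \sum_(_ < _ | _) u _; lia.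
Qed.
End Round.

Lemma eqv_sym n M p q : eqv n M p q -> eqv n M q p.
Proof. by move=> H i j Hi Hj z Hz; rewrite H. Qed.

Lemma eqv_trans n M p q r : eqv n M p q -> eqv n M q r -> eqv n M p r.
Proof. by move=> H H' i j Hi Hj z Hz; rewrite H // H'. Qed.

Lemma eqv_le n M n' M' p q : n' <= n -> M' <= M -> eqv n M p q -> eqv n' M' p q.
Proof. by move=> Hn HM H i j Hi Hj z Hz; apply: H; lia. Qed.

Lemma eqv_reindex n M p q p' q' : eqv n M p q ->
  (forall i, i <= n -> exists2 j, j <= n & p' i = p j /\ q' i = q j) -> eqv n M p' q'.
Proof.
move=> H Hr i j /Hr[i' Hi' [-> ->]] /Hr[j' Hj' [-> ->]]; exact: H.
Qed.

Lemma eqv_cmp n M p q c i j z : eqv n M p q -> i <= n -> j <= n -> (Z.abs z <= Z.of_nat M)%Z ->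
  cmpR c (p i - p j) (IZR z) <-> cmpR c (q i - q j) (IZR z).
Proof.
move=> H Hi Hj Hz; have H1 := H i j Hi Hj z Hz.
have H2 := H j i Hj Hi (- z)%Z ltac:(lia); move: H2; rewrite opp_IZR => H2.
by case: c => /=; lra.
Qed.

Lemma sat_ext nu nu' g : (forall y, nu y = nu' y) -> sat nu g <-> sat nu' g.
Proof.
by move=> E; elim: g => //= [y c z|y y' c z|g1 IH1|g1 IH1 g2 IH2|g1 IH1 g2 IH2]; rewrite ?E; tauto.
Qed.

Lemma sat_points_eqv k x n M p q g : n = k + x.+1 -> x <= M -> eqv n M p q ->
  guard_over x.+1 x g -> sat_points k p g <-> sat_points k q g.
Proof.
move=> En HM H; rewrite /sat_points; elim: g => //= [y c z [Hy Hz]|y y' c z [Hy [Hy' Hz]]|g1 IH1|g1 IH1 g2 IH2 []|g1 IH1 g2 IH2 []].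
- by apply: (eqv_cmp _ H); lia.
- have E (a b d : R) : (a - b - (a - d) = d - b)%R by ring.
  by rewrite !E; apply: (eqv_cmp _ H); lia.
- by tauto.
- by tauto.
- by tauto.
Qed.

Definition nuX k (p : nat -> R) (i : 'I_k) : R := (p 0%N - p i.+1)%R.

Lemma ext_valE k (nu : 'I_k -> R) y (H : y < k) : ext_val nu y = nu (Ordinal H).
Proof.
rewrite /ext_val; case: insubP => [u _ E|]; last by rewrite H.
by congr (nu _); apply: val_inj.
Qed.

Lemma region_equivP k m p q : region_equiv m (nuX (k := k) p) (nuX q) <-> eqv k m p q.
Proof.
have E (o : nat -> R) y : y < k -> ext_val (nuX (k := k) o) y = (o 0%N - o y.+1)%R.
  by move=> H; rewrite ext_valE.
split=> [H i j|H g].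
  have HA y c z : y < k -> (Z.abs z <= Z.of_nat m)%Z ->
      cmpR c (p 0%N - p y.+1) (IZR z) <-> cmpR c (q 0%N - q y.+1) (IZR z).
    by move=> Hy Hz; have := H (GAtom y c z) (conj Hy Hz); rewrite /= !E.
  have HD y y' z : y < k -> y' < k -> (Z.abs z <= Z.of_nat m)%Z ->
      (p y.+1 - p y'.+1 < IZR z)%R <-> (q y.+1 - q y'.+1 < IZR z)%R.
    move=> Hy Hy' Hz; have := H (GDiff y' y CLt z) (conj Hy' (conj Hy Hz)); rewrite /= !E //.
    by split; lra.
  case: i j => [|i] [|j] Hi Hj z Hz; try lra.
  - exact: (HA j CLt).
  - have := HA i CGt (- z)%Z Hi ltac:(lia); rewrite /= opp_IZR; lra.
  - exact: HD.
elim: g => //= [y c z [Hy Hz]|y y' c z [Hy [Hy' Hz]]|g1 IH1|g1 IH1 g2 IH2 []|g1 IH1 g2 IH2 []].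
- by rewrite !E //; apply: (eqv_cmp _ H).
- have E3 (a b d : R) : (a - b - (a - d) = d - b)%R by ring.
  by rewrite !E // !E3; apply: (eqv_cmp _ H).
- by tauto.
- by tauto.
- by tauto.
Qed.

Section Codes.
Variables k m x : nat.
Notation n := (nclk k x).
Notation M := (cmax m x).

Lemma vec_exists (u : nat -> nat) : (forall i, i <= n -> u i <= box k m x) ->
  exists v, v < nvec k m x /\ forall i, i <= n -> get k m x v i = u i.
Proof. by move=> H; apply: (@digits_exist (box k m x).+1 n.+1 u). Qed.

Lemma get_le v i : get k m x v i <= box k m x.
Proof. by rewrite -ltnS; apply: digit_lt. Qed.

(** The points and the later time [t] are rounded together, so the vectors before and after the
    delay share their reset times. This supplies the intermediate vector of [edge_code]. *)
Lemma round_step p t : (p 0%N <= t)%R ->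
  exists v w, [/\ v < nvec k m x, w < nvec k m x, eqv n M (pt k m x v) p,
    eqv n M (pt k m x w) (set_now p t) &
    (forall i, i < n -> get k m x w i.+1 = get k m x v i.+1) /\
    get k m x v 0 <= get k m x w 0].
Proof.
move=> Ht.
(* The later time becomes the additional point at index [n + 1]. *)
pose q i := if i == n.+1 then t else p i.
have [//|u [Hu Hb]] := @round_box n.+2 M q.
have [|v [Hv Ev]] := @vec_exists u; first by move=> i Hi; apply: Hb; lia.
have [|w [Hw Ew]] := @vec_exists (fun i => if i is 0 then u n.+1 else u i).
  by move=> [|i] Hi; apply: Hb; lia.
have L a b z : ((INR a / INR (grid k x) - INR b / INR (grid k x) < IZR z)%R <->
    (Z.of_nat a < Z.of_nat b + z * Z.of_nat (grid k x))%Z) by exact: (grid_cmp k x CLt).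
have Q i : i <= n -> q i = p i by move=> Hi; rewrite /q; case: eqP => //; lia.
have Qt : q n.+1 = t by rewrite /q eqxx.
exists v, w; split=> //.
- move=> i j Hi Hj z Hz; rewrite /pt !Ev // L -Hu ?Q //; lia.
- move=> i j Hi Hj z Hz; rewrite /pt !Ew // L.
  by case: i Hi => [|i] Hi; case: j Hj => [|j] Hj; rewrite -Hu ?Qt ?Q //=; lia.
split; first by move=> i Hi; rewrite Ew ?Ev //; lia.
rewrite Ew // Ev //; have := Hu n.+1 0 ltac:(lia) isT 0%Z ltac:(lia); rewrite Qt Q //.
by move=> [_ h]; case: (leqP (u 0) (u n.+1)) => // h'; have := h ltac:(lia); lra.
Qed.

Lemma reset_codeP (r : rule) Y i : reset_code k (enc_rule r) Y i <->
  (i < k /\ digit 2 Y i = 1) \/ (k <= i /\ i - k \in r_reset r).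
Proof. by rewrite /reset_code /enc_rule !(p1E, p2E) in_code_id. Qed.

Definition reset_points (rst : nat -> Prop) (p : nat -> R) (i : nat) : R :=
  if i is i'.+1 then if excluded_middle_informative (rst i') then p 0%N else p i else p 0%N.

Lemma eqv_reset rst p q : eqv n M p q -> eqv n M (reset_points rst p) (reset_points rst q).
Proof.
move=> H; apply: (eqv_reindex H) => -[|i] Hi /=; first by exists 0.
by case: excluded_middle_informative => ? /=; [exists 0|exists i.+1].
Qed.

Lemma edge_reset e Y u w u' : edge_code k m x e Y u w u' ->
  forall i, i <= n -> pt k m x u' i = reset_points (reset_code k e Y) (pt k m x w) i.
Proof.
case=> v [_ [_ [_ [_ [_ [H0 H]]]]]] [|i] Hi /=; first by rewrite /pt H0.
by rewrite /pt; have [H1 H2] := H i Hi; case: excluded_middle_informative => h /=; rewrite ?(H1 h) ?(H2 h).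
Qed.

Lemma edge_exists e Y u v w : v < nvec k m x ->
  eqv_code k m n M (grid k x) x u v ->
  (forall i, i < n -> get k m x w i.+1 = get k m x v i.+1) ->
  get k m x v 0 <= get k m x w 0 -> sat_code k m x (p1 (p2 (p2 e))) w ->
  exists u', u' < nvec k m x /\ edge_code k m x e Y u w u'.
Proof.
move=> Hv Huv Hw H0 Hs.
have [|u' [Hu' E]] := @vec_exists (fun i => if i is i'.+1 then
   if excluded_middle_informative (reset_code k e Y i') then get k m x w 0 else get k m x w i
   else get k m x w 0).
  by move=> [|i] _; [|case: excluded_middle_informative => ? /=]; apply: get_le.
exists u'; split=> //; exists v; split=> //; do 4 (split=> //); split; first by rewrite E.
by move=> i Hi; rewrite E //; case: excluded_middle_informative.
Qed.
End Codes.

(** * Controller and automaton along one timed run *)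

Section Enumeration.
Variables (isl : nat -> bool) (f : nat -> nat).
Hypotheses (Hf : forall i, f i < f i.+1) (Hl : forall j, isl j <-> exists i, f i = j).

(** The number of rounds of the game completed before step [j]; on letter steps it inverts the
    enumeration [f]. *)
Fixpoint cnt j := if j is j'.+1 then cnt j' + isl j' else 0.

Lemma enum_mono i i' : i < i' -> f i < f i'.
Proof.
elim: i' => // i' IH; rewrite ltnS leq_eqVlt => /orP[/eqP -> //|/IH].
by move/ltn_trans; apply.
Qed.

Lemma cnt_bounds j : (forall i, i < cnt j -> f i < j) /\ j <= f (cnt j) /\
  (isl j -> f (cnt j) = j).
Proof.
have X j' : (forall i, i < cnt j' -> f i < j') -> j' <= f (cnt j') -> isl j' -> f (cnt j') = j'.
  move=> H1 H2 /Hl[i Ei]; case: (ltngtP i (cnt j')) => h; last by rewrite -h.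
    by have := H1 _ h; lia.
  by have := enum_mono h; lia.
elim: j => [|j [H1 [H2 H3]]] /=; first by split=> //; split=> //; apply: X.
suff [A B] : (forall i, i < cnt j.+1 -> f i < j.+1) /\ j < f (cnt j.+1) by split=> //; split=> //; apply: X.
move=> /=; case: (boolP (isl j)) => Hj /=; rewrite ?addn1 ?addn0.
  split; last by have := Hf (cnt j); rewrite H3.
  by move=> i; rewrite ltnS leq_eqVlt => /orP[/eqP ->|/H1]; rewrite ?H3 //; lia.
split; first by move=> i /H1; lia.
rewrite ltn_neqAle H2 andbT; apply/eqP => E; case/negP: Hj; apply/Hl; by exists (cnt j).
Qed.

Lemma enum_cnt j : isl j -> f (cnt j) = j.
Proof. by case: (cnt_bounds j) => _ []. Qed.

Lemma cnt_enum i : cnt (f i) = i.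
Proof.
have E : f (cnt (f i)) = f i by apply: enum_cnt; apply/Hl; exists i.
by case: (ltngtP (cnt (f i)) i) => // /enum_mono; rewrite E ltnn.
Qed.
End Enumeration.

Definition is_letter (r : rule) : bool := if r_lab r is Some _ then true else false.
Arguments is_letter : simpl never.

Section Product.
Variables (k nA nB : nat) (L : Type) (l0 : L)
  (delta : L -> 'I_nA -> ('I_k -> R) -> L * 'I_nB * {set 'I_k})
  (a : nat -> 'I_nA) (t : nat -> R) (r : nat -> rule) (s : nat -> R) (f : nat -> nat).
Notation isl := (fun j => is_letter (r j)).
Hypotheses (Hf : forall i, f i < f i.+1) (Hl : forall j, isl j <-> exists i, f i = j).
Hypothesis Ht : forall i, s (f i) = t i.
Notation cnt := (cnt isl).
Notation st := (ctrl_state l0 delta a t).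
Definition answer i := delta (st i).1 (a i) (elapse t (st i).2 i).

(** A reset time is a date minus a clock value. Controller valuations are dated by the last letter
    and automaton valuations by the last step, so epsilon-steps leave the controller entries
    unchanged. *)
Definition points j i : R :=
  if i is i'.+1 then
    if i' < k then (prev t (cnt j) - ext_val (st (cnt j)).2 i')%R
    else (prev s j - run_val r s j (i' - k))%R
  else prev s j.

Definition resets j i : Prop :=
  (exists H : i < k, isl j /\ Ordinal H \in (answer (cnt j)).2) \/ (k <= i /\ i - k \in r_reset (r j)).

Lemma ctrl_stateS i : st i.+1 = ((answer i).1.1,
  fun y => if y \in (answer i).2 then 0%R else elapse t (st i).2 i y).
Proof. by rewrite /answer /=; case: (st i) => l mu /=; case: (delta _ _ _) => [[l' b] Y]. Qed.

Lemma ctrl_outE i : ctrl_out l0 delta a t i = (answer i).1.2.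
Proof. by rewrite /ctrl_out /answer; case: (st i). Qed.

Lemma pointsS j i : points j.+1 i = reset_points (resets j) (set_now (points j) (s j)) i.
Proof.
case: i => [|i] //=; case: (ltnP i k) => Hi; last first.
  case: excluded_middle_informative => HR /=.
    case: HR => [[H _]|[_ H]]; first lia.
    rewrite H; lra.
  rewrite ifN; last by apply/negP => h; apply: HR; right.
  lra.
rewrite !(ext_valE _ Hi); case: (boolP (is_letter (r j))) => Hj; last first.
  case: excluded_middle_informative => HR /=.
    by case: HR => [[H [h _]]|[H _]]; [rewrite h in Hj|lia].
  by rewrite addn0.
rewrite addn1 ctrl_stateS /=; have Ej := enum_cnt Hf Hl Hj.
have Es : t (cnt j) = s j by rewrite -Ht Ej.
case: excluded_middle_informative => HR /=.
  case: HR => [[H [_ h]]|[H _]]; last lia.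
  by rewrite (bool_irrelevance Hi H) h Es; lra.
rewrite ifN /elapse; first by rewrite Es; lra.
by apply/negP => h; apply: HR; left; exists Hi.
Qed.

Lemma points_elapse j : isl j ->
  forall y, elapse t (st (cnt j)).2 (cnt j) y = nuX (set_now (points j) (s j)) y.
Proof.
move=> Hj [y Hy]; have Ej := enum_cnt Hf Hl Hj.
have Es : t (cnt j) = s j by rewrite -Ht Ej.
rewrite /nuX /= Hy (ext_valE _ Hy) /elapse Es; lra.
Qed.

Lemma points_sat j g :
  sat (fun y => (run_val r s j y + (s j - prev s j))%R) g <->
  sat_points k (set_now (points j) (s j)) g.
Proof.
apply: sat_ext => y /=; rewrite ifN; last by rewrite -leqNgt leq_addr.
rewrite addKn; lra.
Qed.

End Product.

(** * From certificates to controllers *)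

Lemma rule_codeE r : [/\ p1 (enc_rule r) = r_src r, p1 (p2 (enc_rule r)) = enc_lab (r_lab r),
  p1 (p2 (p2 (enc_rule r))) = enc_guard (r_guard r) &
  p2 (p2 (p2 (p2 (enc_rule r)))) = r_dst r].
Proof. by rewrite /enc_rule !(p1E, p2E). Qed.

Lemma instance_codeE I (x := enc_instance I) :
  [/\ p1 x = i_nA I, p1 (p2 x) = i_nB I, init_code x = enc_seq id (ta_init (i_ta I)),
    final_code x = enc_seq id (ta_final (i_ta I)) & rules_code x = enc_seq enc_rule (ta_rules (i_ta I))].
Proof.
by rewrite /x /init_code /final_code /rules_code /ta_code /enc_instance /enc_TA !(p1E, p2E).
Qed.

Lemma rule_le I r (x := enc_instance I) : List.In r (ta_rules (i_ta I)) ->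
  [/\ enc_rule r <= x, r_src r <= x, enc_guard (r_guard r) <= x & r_dst r <= x].
Proof.
move=> Hr; have H := cpair_le.
have He : enc_rule r <= x.
  apply: leq_trans (enc_seq_in enc_rule Hr) _; have := leqnn x; rewrite {1}/x /enc_instance /enc_TA.
  by case/H=> _ /H[_ /H[_ /H[_ ]]].
by move: (He); rewrite {1}/enc_rule => /H[h1 /H[_ /H[h2 /H[_ h3]]]].
Qed.

Lemma init_le I l (x := enc_instance I) : l \in ta_init (i_ta I) -> l <= x.
Proof.
move=> Hl; have H := cpair_le.
apply: leq_trans (enc_seq_in id (proj2 (List_In_mem _ _) Hl)) _; have := leqnn x.
by rewrite {1}/x /enc_instance /enc_TA; case/H=> _ /H[_ /H[]].
Qed.

Lemma flag_codeP I r (b c : bool) :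
  flag_code (enc_instance I) b (enc_rule r) c <-> c = b || (r_src r \in ta_final (i_ta I)).
Proof.
have [_ _ _ Ef _] := instance_codeE I; have [Es _ _ _] := rule_codeE r.
rewrite /flag_code Ef Es in_code_id; move: (_ \in _) => d; case: b; case: c; case: d; lia.
Qed.

Section Controller.
Variables (k m : nat) (I : instance) (rk : nat -> nat -> nat -> nat -> nat).
Notation x := (enc_instance I).
Hypothesis Hcert : certificate k m x rk.
Notation n := (nclk k x).
Notation M := (cmax m x).
Notation memory := 'I_(nmem k m x).

Definition good_answer (p : memory) (a : nat) (c : nat) (o : memory * 'I_(i_nB I) * nat) : Prop :=
  forall f f' : bool, forall r, List.In r (ta_rules (i_ta I)) ->
  r_lab r = Some (a, nat_of_ord o.1.2) -> f' = f || (r_src r \in ta_final (i_ta I)) ->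
  forall u w u', u < nvec k m x -> w < nvec k m x -> u' < nvec k m x ->
  edge_code k m x (enc_rule r) o.2 u w u' -> eqv_code k m k m (grid k x) x w c ->
  0 < rk p f (r_src r) u ->
  0 < rk o.1.1 0 (r_dst r) u' /\ rk o.1.1 0 (r_dst r) u' + f' <= rk p f (r_src r) u.

Lemma answer_exists (p : memory) (a : 'I_(i_nA I)) (c : 'I_(nvec k m x)) :
  exists o, good_answer p a c o.
Proof.
have [EA EB _ _ ER] := instance_codeE I.
have [_ [_ H]] := Hcert.
have [|b [Hb [Y [HY [p' [Hp' H']]]]]] := H p (ltn_ord p) a _ c (ltn_ord c); first by rewrite EA.
move: Hb; rewrite EB => Hb; exists (Ordinal Hp', Ordinal Hb, Y) => f f' r Hr El Ef u w u' Hu Hw Hu' He Hc.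
have [E1 E2 _ E4] := rule_codeE r; have [Hle _ _ _] := rule_le Hr.
have := H' f _ f' _ (enc_rule r) Hle _ _ _ u Hu w Hw u' Hu' He Hc.
rewrite E1 E2 E4 El; apply=> //; [by case: (f)|by case: (f')| |exact/flag_codeP].
by rewrite ER in_codeP; exists r.
Qed.

Lemma nvec_gt0 : 0 < nvec k m x.
Proof. by rewrite expn_gt0. Qed.

(** The choice depends only on which vectors are equivalent to [nu], so equivalent valuations get
    the same representative; this makes [ctrl] region invariant. *)
Definition region_rep (nu : 'I_k -> R) : 'I_(nvec k m x) :=
  odflt (Ordinal nvec_gt0) [pick c : 'I_(nvec k m x) |
    if excluded_middle_informative (region_equiv m nu (nuX (pt k m x c))) then true else false].

Definition reply p a c := proj1_sig (constructive_indefinite_description _ (@answer_exists p a c)).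

Definition ctrl (p : memory) (a : 'I_(i_nA I)) (nu : 'I_k -> R) : memory * 'I_(i_nB I) * {set 'I_k} :=
  let o := reply p a (region_rep nu) in (o.1, [set i : 'I_k | digit 2 o.2 i == 1]).

Lemma ctrl_invariant : region_invariant m ctrl.
Proof.
move=> p a nu nu' H; rewrite /ctrl; suff -> : region_rep nu = region_rep nu' by [].
rewrite /region_rep; congr odflt; apply: eq_pick => c /=.
have E : region_equiv m nu (nuX (pt k m x c)) <-> region_equiv m nu' (nuX (pt k m x c)).
  by split=> H' g Hg; rewrite -H' // H.
have [E1 E2] := E.
case: excluded_middle_informative => h1; case: excluded_middle_informative => h2 //.
  by case: h2; apply: E1.
by case: h1; apply: E2.
Qed.

Theorem certificate_controller : has_winning_controller k m I.
Proof.
have [[p0 [Hp0 Hinit]] [Heps _]] := Hcert.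
have [EA EB EI EF ER] := instance_codeE I.
exists memory, (Ordinal Hp0), ctrl; split; first exact: ctrl_invariant.
move=> a t Hmono [r [s [f [[Hinit' [Hrules [Hdst [Hs [Hg HF]]]]] [Hf [Hl Hw]]]]]].
pose isl j := is_letter (r j).
have Hl' j : isl j <-> exists i, f i = j.
  by rewrite -Hl /isl /is_letter; case: (r_lab (r j)).
have Ht i : s (f i) = t i by have [] := Hw i.
pose P := points (Ordinal Hp0) ctrl a t r s.
pose st i := ctrl_state (Ordinal Hp0) ctrl a t i.
pose c := cnt isl.
pose fl := fix fl j := if j is j'.+1 then ~~ isl j' && (fl j' || (r_src (r j') \in ta_final (i_ta I))) else false.
(* The real run is shadowed by grid vectors of the same region, whose rank is kept positive by the
   certificate. *)
pose Inv j rho := exists u, [/\ u < nvec k m x, eqv n M (pt k m x u) (P j),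
  rk (st (c j)).1 (fl j) (r_src (r j)) u = rho & 0 < rho].
have step j rho : Inv j rho -> exists rho', Inv j.+1 rho' /\
    rho' + (isl j && (fl j || (r_src (r j) \in ta_final (i_ta I)))) <= rho.
  case=> u [Hu Eu Er rho0].
  have PS : forall i, P j.+1 i = _ := pointsS _ _ _ Hf Hl' Ht j.
  have Ple : (P j 0%N <= s j)%R by exact: Hs.
  have [v [w [Hv Hw' Ev Ew [H1 H2]]]] := round_step k m x Ple.
  have Euv : eqv_code k m n M (grid k x) x u v.
    by apply/eqv_codeP; apply: eqv_trans Eu _; apply: eqv_sym.
  have [Hrle _ Hgle _] := rule_le (Hrules j).
  have [Q1 Q2 Q3 Q4] := rule_codeE (r j).
  have Hsat : sat_code k m x (p1 (p2 (p2 (enc_rule (r j))))) w.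
    rewrite Q3; apply/sat_codeP.
    apply/(sat_points_eqv (k := k) (x := x) (n := n) (M := M) erefl (leq_addr _ _) Ew (enc_guard_over Hgle)).
    by apply/points_sat; apply: Hg.
  (* At epsilon-steps the code 0 stands for the empty set of controller resets. *)
  pose Y := if isl j then (reply (st (c j)).1 (a (c j)) (region_rep (elapse t (st (c j)).2 (c j)))).2 else 0.
  have [u' [Hu' He]] := edge_exists Y Hv Euv H1 H2 Hsat.
  have Eu' : eqv n M (pt k m x u') (P j.+1).
    have HR : forall i, reset_code k (enc_rule (r j)) Y i <-> resets (Ordinal Hp0) ctrl a t r j i.
      move=> i; rewrite reset_codeP /resets /Y -/isl -/c; split=> -[]; try by right.
      - case=> Hi; case: (boolP (isl j)) => Hj; last by rewrite digit0.
        by move=> D; left; exists Hi; split=> //; rewrite /answer /ctrl /= inE D.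
      - case=> Hi [Hj]; rewrite -/(isl j) in Hj; rewrite Hj /answer /ctrl /= inE => /eqP D; by left.
    move=> i1 i2 Hi1 Hi2 z Hz; rewrite !(edge_reset He) // !PS.
    apply: (@eqv_reindex n M (pt k m x w) (set_now (P j) (s j)) _ _ Ew _ i1 i2 Hi1 Hi2 z Hz) => -[|i] Hi.
      by exists 0.
    have := HR i => HRi /=.
    case: excluded_middle_informative => A1 /=; case: excluded_middle_informative => A2 /=; try tauto.
      by exists 0.
    by exists i.+1.
  case: (boolP (isl j)) => Hj; last first.
    exists (rk (st (c j)).1 (fl j || (r_src (r j) \in ta_final (i_ta I))) (r_dst (r j)) u').
    have := Heps (st (c j)).1 (ltn_ord _) (fl j) _ (fl j || (r_src (r j) \in ta_final (i_ta I))) _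
        (enc_rule (r j)) Hrle _ _ _ u Hu w Hw' u' Hu'.
    rewrite Q1 Q2 Q4 Er /= addn0; case=> //.
    + by case: (fl j).
    + by case: (_ || _).
    + by rewrite ER in_codeP; exists (r j).
    + by move: Hj; rewrite /isl /is_letter; case: (r_lab (r j)).
    + exact/flag_codeP.
    + by move: He; rewrite /Y (negbTE Hj).
    move=> G1 G2; split=> //; exists u'; split=> //.
    by rewrite /= -/isl -/c Hdst -/isl (negbTE Hj) addn0.
  have Ej := enum_cnt Hf Hl' Hj; rewrite -/c in Ej.
  set cc := region_rep (elapse t (st (c j)).2 (c j)).
  have Hcc : eqv_code k m k m (grid k x) x w cc.
    have Hk : eqv k m (pt k m x w) (set_now (P j) (s j)).
      by apply: eqv_le Ew; rewrite /nclk /cmax; lia.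
    have Hel : region_equiv m (elapse t (st (c j)).2 (c j)) (nuX (pt k m x w)).
      have R1 := proj2 (region_equivP k m _ _) (eqv_sym Hk).
      move=> g Hg'; rewrite -(R1 g Hg'); apply: sat_ext => y.
      by rewrite /ext_val; case: insubP => // y' _ _; apply: (points_elapse _ _ _ Hf Hl' Ht Hj).
    apply/eqv_codeP; apply/region_equivP; rewrite /cc /region_rep; case: pickP => [c'|/(_ (Ordinal Hw'))] /=.
      by case: excluded_middle_informative => // h _ g Hg'; rewrite -(Hel g Hg') (h g Hg').
    by case: excluded_middle_informative.
  have HY : Y = (reply (st (c j)).1 (a (c j)) cc).2 by rewrite /Y Hj.
  have Hlab : r_lab (r j) = Some (nat_of_ord (a (c j)), nat_of_ord (reply (st (c j)).1 (a (c j)) cc).1.2).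
    have [h _] := Hw (c j); move: h; rewrite Ej ctrl_outE => ->; by rewrite /answer /ctrl.
  have := proj2_sig (constructive_indefinite_description _ (@answer_exists (st (c j)).1 (a (c j)) cc)).
  rewrite -/(reply _ _ _) => GA.
  have := GA (fl j) _ (r j) (Hrules j) Hlab erefl u w u' Hu Hw' Hu'.
  rewrite -HY Er => /(_ He Hcc rho0) [G1 G2].
  eexists; split; last exact: G2.
  exists u'; split=> //.
  by rewrite /= -/isl -/c Hj addn1 /st ctrl_stateS -Hdst.
have Inv0 : exists rho, Inv 0 rho.
  exists (rk p0 0 (r_src (r 0)) 0); exists 0; split=> //.
  - exact: nvec_gt0.
  - have Z0 i : pt k m x 0 i = 0%R by rewrite /pt /get digit0 /= /Rdiv Rmult_0_l.
    have Z1 i : P 0 i = 0%R.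
      case: i => [|i] //=; case: ifP => Hi; last by lra.
      by rewrite (ext_valE _ Hi) /=; lra.
    by move=> i1 i2 _ _ z _; rewrite !Z0 !Z1.
  - by apply: Hinit; [exact: init_le|rewrite EI in_code_id].
have Hmon j j' rho : j <= j' -> Inv j rho -> exists rho', Inv j' rho' /\ rho' <= rho.
  move=> jj' H; elim: j' jj' => [|j' IH]; first by rewrite leqn0 => /eqP <-; exists rho.
  rewrite leq_eqVlt => /orP[/eqP <-|]; first by exists rho.
  rewrite ltnS => /IH[r1 [/step[r2 [H2 H3]] H1]]; exists r2; split=> //; lia.
have Hlet j : exists j', [/\ j <= j', isl j' & forall i, j <= i -> i < j' -> ~~ isl i].
  have Hex : exists j', (j <= j') && isl j'.
    exists (f j); apply/andP; split; last by apply/Hl'; exists j.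
    by elim: (j) => // i IH; apply: leq_ltn_trans IH (Hf i).
  case: (ex_minnP Hex) => j' /andP[h1 h2] Hm; exists j'; split=> // i h3 h4.
  by apply/negP => h5; have := Hm i; rewrite h3 h5 => /(_ isT); lia.
(* Strong induction on the rank: after a visit to a final location the flag stays up until the next
   letter, where the rank drops strictly. *)
have desc rho : forall j, ~ Inv j rho.
  have [b] := ubnP rho; elim: b rho => // b IH rho Hb j HI.
  have [j1 [J1 F1]] := HF j; have [j2 [J2 L2 N2]] := Hlet j1.
  have [rho2 [I2 Le2]] := Hmon j j2 rho (leq_trans J1 J2) HI.
  have Fl2 : fl j2 || (r_src (r j2) \in ta_final (i_ta I)).
    have : forall i, j1 <= i -> i <= j2 -> fl i || (r_src (r i) \in ta_final (i_ta I)).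
      elim=> [|i IHi]; first by rewrite leqn0 => /eqP E; rewrite -E F1 orbT.
      rewrite leq_eqVlt => /orP[/eqP <-|]; first by rewrite F1 orbT.
      rewrite ltnS => h1 h2; have h3 := IHi h1 (ltnW h2).
      by rewrite /= (N2 i h1 h2) h3.
    by apply.
  have [rho3 [I3 Le3]] := step j2 rho2 I2.
  by apply: (IH rho3 _ j2.+1 I3); move: Le3; rewrite L2 Fl2 /=; lia.
by case: Inv0 => rho; apply: desc.
Qed.
End Controller.

(** * From controllers to certificates *)

Definition asb (P : Prop) : bool := if excluded_middle_informative P then true else false.
Lemma asbP P : reflect P (asb P).
Proof. by rewrite /asb; case: excluded_middle_informative => h; constructor. Qed.

Lemma enum_infinite (isl : nat -> bool) : (forall N, exists j, N <= j /\ isl j) ->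
  exists f : nat -> nat, (forall i, f i < f i.+1) /\ (forall j, isl j <-> exists i, f i = j).
Proof.
move=> H; have Hex N : exists j, (N <= j) && isl j.
  by have [j [h1 h2]] := H N; exists j; rewrite h1.
pose nx N := ex_minn (Hex N).
have nxP N : [/\ N <= nx N, isl (nx N) & forall j, N <= j -> isl j -> nx N <= j].
  rewrite /nx; case: ex_minnP => j /andP[h1 h2] h3; split=> // j' h4 h5.
  by apply: h3; rewrite h4.
pose f := fix f i := if i is i'.+1 then nx (f i').+1 else nx 0.
have Hf i : f i < f i.+1 by have [] := nxP (f i).+1.
exists f; split=> // j; split; last first.
  by case=> i <-; case: i => [|i]; [have [] := nxP 0|have [] := nxP (f i).+1].
move=> Hj; have Hge i : i <= f i by elim: i => // i IH; apply: leq_ltn_trans IH (Hf i).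
have Hle i : (exists i', f i' = j) \/ f i < j.
  elim: i => [|i [|h]]; [|by left|].
    have [_ _ /(_ j isT Hj)] := nxP 0; rewrite leq_eqVlt => /orP[/eqP E|]; last by right.
    by left; exists 0.
  have [_ _ /(_ j h Hj)] := nxP (f i).+1; rewrite leq_eqVlt => /orP[/eqP E|]; last by right.
  by left; exists i.+1.
by case: (Hle j) => // h; have := Hge j; lia.
Qed.

(** * The finite game on grid vectors *)

Section Discrete.
Variables (k m : nat) (I : instance).
Notation x := (enc_instance I).
Notation n := (nclk k x).
Notation M := (cmax m x).
Notation nv := (nvec k m x).

Definition dstate : finType := (bool * 'I_x.+1 * 'I_nv)%type.
Definition dinput : finType := ('I_(i_nA I) * 'I_nv)%type.
Definition doutput : finType := ('I_(i_nB I) * 'I_(2 ^ k))%type.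
Implicit Types q : dstate.

Definition dinit : pred dstate := fun q => [&& ~~ q.1.1, val q.1.2 \in ta_init (i_ta I) & val q.2 == 0].

Definition drule r q q' := List.In r (ta_rules (i_ta I)) /\ r_src r = q.1.2 /\ r_dst r = q'.1.2.
Definition dflag r q := q.1.1 || (r_src r \in ta_final (i_ta I)).

Definition deps : rel dstate := fun q q' => asb (exists r w,
  [/\ drule r q q', r_lab r = None, q'.1.1 = dflag r q, w < nv &
    edge_code k m x (enc_rule r) 0 q.2 w q'.2]).

Definition dlett (i : dinput) (o : doutput) q (f : bool) q' : bool := asb (exists r w,
  [/\ drule r q q', r_lab r = Some (val i.1, val o.1), q'.1.1 = false, f = dflag r q &
   [/\ w < nv, edge_code k m x (enc_rule r) o.2 q.2 w q'.2 &
     eqv_code k m k m (grid k x) x w i.2]]).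

Section FromController.
Variables (L : finType) (l0 : L)
  (delta : L -> 'I_(i_nA I) -> ('I_k -> R) -> L * 'I_(i_nB I) * {set 'I_k}).
Hypothesis Hinv : region_invariant m delta.
Hypothesis Hwin : forall (a : nat -> 'I_(i_nA I)) (t : nat -> R),
  (forall n, (prev t n <= t n)%R) ->
  ~ in_lang (i_ta I)
    (fun n => ((a n, ctrl_out l0 delta a t n), t n) : ('I_(i_nA I) * 'I_(i_nB I)) * R).

Lemma set_code_exists (Y : {set 'I_k}) :
  exists c : 'I_(2 ^ k), forall i : 'I_k, digit 2 c i = (i \in Y).
Proof.
have [|y [Hy E]] := @digits_exist 2 k (fun i => if insub i is Some j then (j : 'I_k) \in Y else false) isT.
  by move=> i Hi; case: insub => // j; case: (_ \in _).
exists (Ordinal Hy) => i; rewrite /= E ?ltn_ord //; by rewrite valK.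
Qed.
Definition set_code Y := proj1_sig (constructive_indefinite_description _ (set_code_exists Y)).
Lemma set_codeE Y (i : 'I_k) : digit 2 (set_code Y) i = (i \in Y).
Proof. exact: (proj2_sig (constructive_indefinite_description _ (set_code_exists Y))). Qed.

Definition danswer l (i : dinput) := delta l i.1 (nuX (pt k m x i.2)).
Definition dout l (i : dinput) : doutput := ((danswer l i).1.2, set_code (danswer l i).2).
Definition dnxt l (i : dinput) := (danswer l i).1.1.

Section Path.
Variable p : nat -> L * dstate.
Hypotheses (P0 : ginit dinit l0 (p 0)) (Pe : forall j, gedge deps dlett dout dnxt (p j) (p j.+1))
  (Pi : forall N, exists j, N <= j /\ gletter dlett dout dnxt true (p j) (p j.+1)).
Notation lo j := (p j).1.
Notation fl j := (p j).2.1.1.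
Notation loc j := (p j).2.1.2.
Notation ve j := (p j).2.2.

Definition out_code j (ac : option dinput) : nat := if ac is Some i then (dout (lo j) i).2 else 0.

Definition path_spec j (path_data : rule * nat * option dinput) :=
  let: (r, w, ac) := path_data in
  [/\ drule r (p j).2 (p j.+1).2, w < nv, edge_code k m x (enc_rule r) (out_code j ac) (ve j) w (ve j.+1),
    if ac is Some i then
      [/\ r_lab r = Some (val i.1, val (dout (lo j) i).1), lo j.+1 = dnxt (lo j) i,
        fl j.+1 = false & eqv_code k m k m (grid k x) x w i.2]
    else [/\ r_lab r = None, lo j.+1 = lo j & fl j.+1 = dflag r (p j).2] &
    gletter dlett dout dnxt true (p j) (p j.+1) -> ac /\ dflag r (p j).2].

Lemma path_spec_exists j : exists path_data, path_spec j path_data.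
Proof.
have HL b : gletter dlett dout dnxt b (p j) (p j.+1) ->
    (gletter dlett dout dnxt true (p j) (p j.+1) -> b) -> exists path_data, path_spec j path_data.
  case/existsP=> i /andP[/eqP E /asbP[r [w [H1 H2 H3 H4 [H5 H6 H7]]]]] Hb.
  exists (r, w, Some i); split=> //.
  by move/Hb => tb; split=> //; rewrite -H4.
case: (boolP (gletter dlett dout dnxt true (p j) (p j.+1))) => [h|h]; first exact: (HL true).
have := Pe j; rewrite /= (negbTE h) orbF => /orP[/andP[/eqP E /asbP[r [w [H1 H2 H3 H4 H5]]]]|h'].
  by exists (r, w, None); split=> //; rewrite (negbTE h).
by apply: (HL false) => //; rewrite (negbTE h).
Qed.

Definition path_data j := proj1_sig (constructive_indefinite_description _ (path_spec_exists j)).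
Definition path_rule j := (path_data j).1.1.
Definition path_vec j := (path_data j).1.2.
Definition path_input j := (path_data j).2.

Lemma path_dataP j : path_spec j (path_rule j, path_vec j, path_input j).
Proof.
have := proj2_sig (constructive_indefinite_description _ (path_spec_exists j)).
by rewrite -/(path_data j) /path_rule /path_vec /path_input; case: (path_data j) => [[]].
Qed.

Lemma is_letterE j : is_letter (path_rule j) = path_input j.
Proof.
have [_ _ _ H _] := path_dataP j; move: H; rewrite /is_letter; case: (path_input j) => [i|].
  by case=> ->.
by case=> ->.
Qed.

Definition path_reset j := reset_code k (enc_rule (path_rule j)) (out_code j (path_input j)).
(** [epsilon] allows the times to be defined before the invariant [real_points_ok], under which
    [elapse_match] provides one, is proved along them. *)
Definition next_time j (q : nat -> R) : R :=
  epsilon (inhabits 0%R) (fun t => (q 0%N <= t)%R /\ eqv n M (set_now q t) (pt k m x (path_vec j))).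
Fixpoint real_points j : nat -> R :=
  if j is j'.+1 then reset_points (path_reset j') (set_now (real_points j') (next_time j' (real_points j'))) else fun _ => 0%R.
Definition real_time j := next_time j (real_points j).


Definition real_points_ok j := eqv n M (real_points j) (pt k m x (ve j)) /\
  forall i, i <= n -> (real_points j i <= real_points j 0%N)%R.

Lemma real_points_step j : real_points_ok j ->
  (real_points j 0%N <= real_time j)%R /\ eqv n M (set_now (real_points j) (real_time j)) (pt k m x (path_vec j)).
Proof.
case=> He Hle; rewrite /real_time /next_time; apply (epsilon_spec (inhabits 0%R)).
have [_ _ [v [Hv [Huv [Hw [H0 _]]]]] _ _] := path_dataP j.
move/eqv_codeP in Huv.
have Hrv : eqv n M (pt k m x v) (real_points j) := eqv_trans (eqv_sym Huv) (eqv_sym He).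
have [||t [Ht1 Ht2]] := elapse_match (t := pt k m x (path_vec j) 0) Hrv.
- move=> i Hi; have := Hrv 0 i isT Hi 0%Z ltac:(lia); have := Hle i Hi; lra.
- have h1 : (INR (get k m x v 0) <= INR (get k m x (path_vec j) 0))%R by apply: le_INR; apply/leP.
  have h2 := Rinv_0_lt_compat _ (grid_pos k x).
  exact: (Rmult_le_compat_r _ _ _ (Rlt_le _ _ h2) h1).
exists t; split=> //; apply: (eqv_trans (eqv_sym Ht2)) => i1 i2 Hi1 Hi2 z Hz.
have E i : i <= n -> set_now (pt k m x v) (pt k m x (path_vec j) 0) i = pt k m x (path_vec j) i.
  by case: i => [|i] Hi //=; rewrite /pt Hw.
by rewrite !E.
Qed.

Lemma real_points_inv j : real_points_ok j.
Proof.
elim: j => [|j IH].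
  split; last by move=> i _ /=; lra.
  case/andP: P0 => _ /and3P[_ _ /eqP E0].
  by move=> i1 i2 _ _ z _; rewrite /= E0 /pt /get !digit0 /= /Rdiv Rmult_0_l.
have [H1 H2] := real_points_step IH; case: IH => IH1 IH2; split.
  have [_ _ He _ _] := path_dataP j.
  move=> i1 i2 Hi1 Hi2 z Hz; rewrite !(edge_reset He) //.
  exact: (eqv_reset (path_reset j) H2 Hi1 Hi2 Hz).
case=> [|i] Hi /=; first lra.
by case: excluded_middle_informative => ? /=; rewrite -/(real_time j); [lra|have := IH2 i.+1 Hi; lra].
Qed.

Lemma real_time_prev j : prev real_time j = real_points j 0%N.
Proof. by case: j. Qed.

Lemma real_time_mono j : (prev real_time j <= real_time j)%R.
Proof. by rewrite real_time_prev; have [] := real_points_step (real_points_inv j). Qed.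

Lemma path_letters N : exists j, N <= j /\ is_letter (path_rule j).
Proof.
have [j [Hj Hg]] := Pi N; exists j; split=> //.
by rewrite is_letterE; have [_ _ _ _ /(_ Hg) []] := path_dataP j.
Qed.

(** A letter clears the flag, so between two accepting letters some rule must have left a final
    location to raise it again. *)
Lemma path_final N : exists j, N <= j /\ r_src (path_rule j) \in ta_final (i_ta I).
Proof.
have [j1 [Hj1 Hg1]] := Pi N; have [j2 [Hj2 Hg2]] := Pi j1.+1.
have F1 : fl j1.+1 = false.
  have [_ _ _ H /(_ Hg1) [Ha _]] := path_dataP j1; by move: H; case: (path_input j1) Ha => // i _ [].
apply: NNPP => Hno.
have HF j : N <= j -> (r_src (path_rule j) \in ta_final (i_ta I)) = false.
  by move=> h; apply/negP => h'; apply: Hno; exists j.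
have HS j : N <= j -> fl j = false -> fl j.+1 = false.
  move=> h h'; have [_ _ _ H _] := path_dataP j; move: H; case: (path_input j) => [i [] //|[_ _ ->]].
  by rewrite /dflag h' HF.
have Hfl : forall j, j1 < j -> fl j = false.
  elim=> // j IH; rewrite ltnS leq_eqVlt => /orP[/eqP <- //|/[dup] h /IH]; apply: HS; lia.
have [_ _ _ _ /(_ Hg2) [_]] := path_dataP j2; rewrite /dflag Hfl // HF //; lia.
Qed.

Lemma no_path : False.
Proof.
have [f [Hf Hl]] := enum_infinite path_letters.
have [i0 _] : exists i0 : dinput, True.
  have [j [_ Hj]] := path_letters 0; move: Hj; rewrite is_letterE.
  by case: (path_input j) => // i _; exists i.
pose inp i := odflt i0 (path_input (f i)).
pose a i := (inp i).1; pose t i := real_time (f i).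
have Hmono i : (prev t i <= t i)%R.
  have Hm j j' : j <= j' -> (prev real_time j <= prev real_time j')%R.
    elim: j' => [|j' IH]; first by rewrite leqn0 => /eqP ->; lra.
    rewrite leq_eqVlt => /orP[/eqP -> |]; first lra.
    by rewrite ltnS => /IH; have := real_time_mono j'; rewrite /=; lra.
  case: i => [|i] /=; rewrite /t.
    by have := Hm 0 (f 0).+1 isT; rewrite /=; lra.
  exact: (Hm (f i).+1 (f i.+1).+1 (ltnW (Hf i))).
apply: (@Hwin a t Hmono).
pose isl j := is_letter (path_rule j).
pose c := cnt isl.
pose P := points l0 delta a t path_rule real_time.
have Ht i : real_time (f i) = t i by [].
have PS j i : P j.+1 i = reset_points (resets l0 delta a t path_rule j) (set_now (P j) (real_time j)) i.
  exact: pointsS Hf Hl Ht j i.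
have Hfc j : isl j -> f (c j) = j := enum_cnt Hf Hl (j := j).
(* By region invariance, the answer at the real valuation is the one given at the grid vector of the
   path. *)
have Hans j : lo j = (ctrl_state l0 delta a t (c j)).1 -> (forall i, i <= n -> real_points j i = P j i) ->
    forall i, path_input j = Some i -> answer l0 delta a t (c j) = danswer (lo j) i.
  move=> El EP i Ei; have Hj : isl j by rewrite /isl is_letterE Ei.
  have [_ _ _ H _] := path_dataP j; move: H; rewrite Ei => -[_ _ _ Hc].
  have [_ Hw] := real_points_step (real_points_inv j).
  rewrite /answer -El /a /inp (Hfc j Hj) Ei /= /danswer; apply: Hinv.
  have R1 : region_equiv m (nuX (k := k) (set_now (P j) (real_time j))) (nuX (pt k m x i.2)).
    apply/region_equivP; move/eqv_codeP in Hc; apply: (eqv_trans _ Hc).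
    have Hw' := eqv_le (n' := k) (M' := m) (leq_addr _ _) (leq_addl _ _) Hw.
    move=> i1 i2 Hi1 Hi2 z Hz; rewrite -(Hw' _ _ Hi1 Hi2 z Hz).
    have E i' : i' <= k -> set_now (P j) (real_time j) i' = set_now (real_points j) (real_time j) i'.
      case: i' => [|i'] h //=; symmetry; apply: EP; rewrite /nclk; lia.
    by rewrite !E.
  move=> g Hg; rewrite -(R1 g Hg); apply: sat_ext => y; rewrite /ext_val; case: insubP => // y' _ _.
  exact: (points_elapse _ _ _ Hf Hl Ht Hj).
(* The real points were built from the path alone; playing the controller against the resulting
   moves reproduces its states and its clocks. *)
have main j : lo j = (ctrl_state l0 delta a t (c j)).1 /\ (forall i, i <= n -> real_points j i = P j i).
  elim: j => [|j [El EP]].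
    case/andP: P0 => /eqP E _; split=> // -[|i] Hi //=; case: ifP => h; last lra.
    by rewrite (ext_valE _ h) /=; lra.
  have Ha := Hans j El EP; have [_ _ _ H _] := path_dataP j; split.
    rewrite /c /= -/c; move: H (is_letterE j) Ha; rewrite /isl; case: (path_input j) => [i|] /=.
      by case=> _ -> _ _ -> /(_ i erefl) Ea; rewrite addn1 ctrl_stateS /= Ea.
    by case=> _ -> _ -> _; rewrite addn0.
  move=> i Hi; rewrite PS /=; case: i Hi => [|i] Hi //=; rewrite EP //.
  have HR : path_reset j i <-> resets l0 delta a t path_rule j i.
    rewrite /path_reset reset_codeP /resets -/isl -/c; move: H (is_letterE j) Ha => _.
    rewrite -/(isl j); case: (path_input j) => [i'|] /= -> Ha'.
      have {}Ha' := Ha' i' erefl; split=> -[[h1 h2]|h]; try by right.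
        left; exists h1; split=> //; move: h2; rewrite Ha' (set_codeE _ (Ordinal h1)).
        by case: (_ \in _).
      left; split=> //; case: h2 => _ h2; have -> := set_codeE (danswer (lo j) i').2 (Ordinal h1).
      by rewrite -Ha' h2.
    split=> -[[h1 h2]|h]; try by right.
      by rewrite digit0 in h2.
    by case: h2.
  by case: excluded_middle_informative => A1; case: excluded_middle_informative => A2 //=; tauto.
have letter i : exists i', [/\ path_input (f i) = Some i', a i = i'.1 &
    ctrl_out l0 delta a t i = (dout (lo (f i)) i').1].
  have Hj : isl (f i) by apply/Hl; exists i.
  have [El EP] := main (f i).
  case E: (path_input (f i)) => [i'|]; last by move: Hj; rewrite /isl is_letterE E.
  exists i'; split=> //; first by rewrite /a /inp E.
  by rewrite ctrl_outE -{1}(cnt_enum Hf Hl i) -/isl -/c (Hans _ El EP _ E).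
exists path_rule, real_time, f; split; last split=> //; last split.
- have DR j : drule (path_rule j) (p j).2 (p j.+1).2 by have [] := path_dataP j.
  split; [|split; [|split; [|split; [|split]]]].
  + by have [_ [-> _]] := DR 0; case/andP: P0 => _ /and3P[_ ].
  + by move=> j; have [] := DR j.
  + by move=> j; have [_ [_ ->]] := DR j; have [_ [-> _]] := DR j.+1.
  + exact: real_time_mono.
  + move=> j; apply/(points_sat l0 delta a t).
    have [Hin _] := DR j; have [_ _ Hgle _] := rule_le Hin.
    have [_ Hw] := real_points_step (real_points_inv j); have [_ EP] := main j.
    apply/(sat_points_eqv (q := pt k m x (path_vec j)) (k := k) (x := x) (n := n) (M := M) erefl (leq_addr _ _) _ (enc_guard_over Hgle)).
      move=> i1 i2 Hi1 Hi2 z Hz; rewrite -(Hw i1 i2 Hi1 Hi2 z Hz).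
      have E i' : i' <= n -> set_now (points l0 delta a t path_rule real_time j) (real_time j) i' = set_now (real_points j) (real_time j) i'.
        by case: i' => [|i'] h //; rewrite /set_now EP.
      by rewrite !E //; apply: iff_refl.
    have [_ _ [v [_ [_ [_ [_ [Hs _]]]]]] _ _] := path_dataP j.
    by apply/sat_codeP; have [_ _ <- _] := rule_codeE (path_rule j).
  + exact: path_final.
- move=> j; rewrite -Hl /is_letter; by case: (r_lab (path_rule j)).
- move=> i; split=> //=; have [i' [E1 E2 E3]] := letter i.
  by have [_ _ _ H _] := path_dataP (f i); move: H; rewrite E1 => -[-> _ _ _]; rewrite E2 E3.
Qed.
End Path.

Theorem controller_winning : winning dinit deps dlett l0 dout dnxt.
Proof. by case/lasso_path => p [h1 h2 h3]; apply: (@no_path p). Qed.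
End FromController.

Lemma card_dstate : #|{: dstate}| = nstate k m x.
Proof. by rewrite !card_prod card_bool !card_ord. Qed.

Theorem controller_certificate : has_winning_controller k m I -> has_certificate k m x.
Proof.
case=> L [l0 [delta [Hinv Hwin]]].
have := bounded_certificate (controller_winning Hinv Hwin).
rewrite -[#|_|]/(#|{: dstate}|) card_dstate -/(nmem k m x) => -[rk [p0 [R1 R2 R3 R4]]].
have [EA EB EI EF ER] := instance_codeE I.
(* Inverts the mixed-radix numbering of [state_index]. *)
pose g idx := if (insub (idx %% nv) : option 'I_nv) is Some u then
  if (insub ((idx %/ nv) %% x.+1) : option 'I_x.+1) is Some l then
  if (insub (idx %/ nv %/ x.+1 %/ 2) : option 'I_(nmem k m x)) is Some p then
    rk p (odd (idx %/ nv %/ x.+1), l, u) else 0 else 0 else 0.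
have [|y [Hy Ey]] := @digits_exist (maxrank k m x) (nmem k m x * nstate k m x) g isT.
  move=> i _; rewrite /g /maxrank ltnS; case: insub => // u; case: insub => // l; by case: insub.
have T p (b : bool) (l : 'I_x.+1) (u : 'I_nv) : table k m x y (p : 'I_(nmem k m x)) b l u = rk p (b, l, u).
  rewrite /table Ey /state_index; last first.
    have := ltn_ord p; have := ltn_ord l; have := ltn_ord u; rewrite /nstate.
    move: (nmem k m x) (nv) (x.+1) (nat_of_ord p) (nat_of_ord l) (nat_of_ord u) => H v z p' l' u' h1 h2 h3.
    have b1 : b <= 1 by case: b.
    have h4 : p' * 2 + b < H * 2 by lia.
    have h5 : (p' * 2 + b) * z + l' < H * 2 * z by nia.
    by nia.
  have v0 : 0 < nv by apply: leq_ltn_trans (ltn_ord u).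
  rewrite /g divnMDl // modnMDl (modn_small (ltn_ord u)) (divn_small (ltn_ord u)) addn0.
  rewrite divnMDl // modnMDl (modn_small (ltn_ord l)) (divn_small (ltn_ord l)) addn0 divnMDl //.
  rewrite !valK oddD oddM andbF /= oddb (divn_small (_ : b < 2)) ?addn0 ?valK //; by case: b.
have inR e : in_code (rules_code x) e -> exists2 r, List.In r (ta_rules (i_ta I)) & e = enc_rule r.
  by rewrite ER in_codeP => -[r [h1 h2]]; exists r.
have bool2 b : b < 2 -> exists b' : bool, b = b' by case: b => [|[|//]] _; [exists false|exists true].
exists y; split=> //; split; [|split].
- exists p0; split=> // l; rewrite ltnS => Hl; rewrite EI in_code_id => Hin.
  have v0 : 0 < nv by rewrite expn_gt0.
  have := T p0 false (Ordinal (Hl : l < x.+1)) (Ordinal v0) => /= ->; apply: R2.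
  by rewrite /dinit /= Hin.
- move=> p Hp b /bool2[b' ->] f /bool2[f' ->] e He /inR[r Hr Ee] Hlab; rewrite Ee => /flag_codeP Hf.
  move=> u Hu w Hw u' Hu' Hedge.
  have [Q1 Q2 Q3 Q4] := rule_codeE r; have [h1 h2 h3 h4] := rule_le Hr.
  rewrite Q1 Q4 (T (Ordinal Hp) b' (Ordinal (h2 : r_src r < x.+1)) (Ordinal Hu)).
  rewrite (T (Ordinal Hp) f' (Ordinal (h4 : r_dst r < x.+1)) (Ordinal Hu')) => h0.
  apply/andP; apply: R3 h0; apply/asbP; exists r, w; split=> //.
  by move: Hlab; rewrite Ee Q2; case: (r_lab r) => // -[].
- move=> p Hp a Ha c Hc; have Ha' : a < i_nA I by rewrite -EA.
  have [[b Y] [p' Hp']] := R4 (Ordinal Hp) (Ordinal Ha', Ordinal Hc).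
  exists b; split; first by rewrite EB.
  exists Y; split=> //; exists p'; split=> //.
  move=> f0 /bool2[f ->] f1 /bool2[f' ->] e He /inR[r Hr Ee] Hlab; rewrite Ee => /flag_codeP Hf.
  move=> u Hu w Hw u' Hu' Hedge Heqv.
  have [Q1 Q2 Q3 Q4] := rule_codeE r; have [h1 h2 h3 h4] := rule_le Hr.
  rewrite Q1 Q4 (T (Ordinal Hp) f (Ordinal (h2 : r_src r < x.+1)) (Ordinal Hu)).
  rewrite (T p' false (Ordinal (h4 : r_dst r < x.+1)) (Ordinal Hu')) => h0.
  apply: Hp' h0; apply/asbP; exists r, w; split=> //.
  by move: Hlab; rewrite Ee Q2; case: (r_lab r) => // -[a' b'] [] /cpair_inj[-> ->].
Qed.
End Discrete.

Theorem theorem2 :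
  forall k m : nat,
    computably_decidable enc_instance (fun I : instance => has_winning_controller k m I).
Proof.
move=> k m; apply: decidable_computably (dec_certificate k m) _ => I; split.
  exact: controller_certificate.
case=> y [_ H]; exact: certificate_controller H.
Qed.
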